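(* Let $k\in\mathbb{Z}$ and let $m=r+36k$ be a square-free integer with $m\neq 0,\pm 1$, where $r\in\{1,2,3,5,6,7,10,11,13,14,15,17,19,21,22,23,25,26,29,30,31,33,34,35\}$. Let $K=\mathbb{Q}(\sqrt[6]{m})$. Then $K$ is monogenic if $r\in\{2,3,6,7,11,14,15,22,23,30,31,34\}$, and $K$ is not monogenic if $r\in\{1,5,10,13,17,19,21,25,26,29,33,35\}$.
   Context: A number field $K$ with ring of integers $\mathbb{Z}_K$ is called monogenic if there exists $\alpha\in\mathbb{Z}_K$ with $\mathbb{Z}_K=\mathbb{Z}[\alpha]$, i.e. $(1,\alpha,\ldots,\alpha^{\deg K-1})$ is an integral basis (a power integral basis). *)

(* Defs.v *)
From mathcomp Require Export all_boot all_order all_algebra all_field.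

Set Implicit Arguments.
Unset Strict Implicit.
Unset Printing Implicit Defensive.

Import GRing.Theory Num.Theory.
Local Open Scope ring_scope.

(* The case d = 2 excludes m = 0. *)
Definition squarefreez (m : int) : Prop :=
  forall d : int, (d ^+ 2 %| m)%Z -> d \is a GRing.unit.

(* Number fields are the inhabitants of [fieldExtType rat]: field extensions
   of the rationals of finite degree. *)
Definition ring_of_integers (K : fieldExtType rat) (x : K) : Prop :=
  integralOver (intr : int -> K) x.

(* Membership in Z[alpha]. *)
Definition in_Zadjoin (K : fieldExtType rat) (alpha x : K) : Prop :=
  exists p : {poly int}, x = (map_poly (intr : int -> K) p).[alpha].

Definition monogenic (K : fieldExtType rat) : Prop :=
  exists alpha : K, ring_of_integers alpha /\
    forall x : K, ring_of_integers x <-> in_Zadjoin alpha x.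

(* Main.v *)
From HB Require Import structures.
Require Import Defs.
From mathcomp Require Import all_boot all_order all_algebra all_field.
From mathcomp Require Import ring zify.

Set Implicit Arguments.
Unset Strict Implicit.
Unset Printing Implicit Defensive.

Import Order.TTheory GRing.Theory Num.Theory.
Local Open Scope ring_scope.

(* An order is all of Z_K as soon as it is saturated at every prime p, meaning
   that it contains every integer z with p z in it.  For Z[theta] this is
   Dedekind's criterion; it holds at all p when m = 2, 3 (mod 4) and m is not
   +-1 (mod 9), so then theta generates Z_K.

   If m = 1 (mod 4), then O = Z[theta, (1 + theta^3) / 2] is saturated at 2 and
   x^4 - x lies in 2 O for all x in O.  Hence every integer x satisfies
   x^4 = x modulo 2 Z_K, which is impossible if Z_K = Z[x], since Z_K / 2 Z_K is
   then F_2[X] / (g) with g of degree 6.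

   If m = eps + 9 n with eps = +-1 and m = 2, 3 (mod 4), then
   Z_K = Z[theta] + Z[theta] rho with rho = (theta^2 - eps)^2 / 3.  If alpha
   generates Z_K, then each difference of two conjugates of alpha divides the
   corresponding difference for every integer z.  Grouping the pairs of
   conjugates theta zeta^i, theta zeta^j by |i - j| = 3, 2, 1 and taking norms
   turns this into divisibilities between three integral index forms, which,
   applied to z = theta, rho, rho + theta, force F1, F2, F3 = +-1 for alpha.  But
   modulo m one has F1^2 = F3 = 1 and F2 = 9, and F2 = F3 modulo 4, so that m
   divides 8 or 2. *)

Notation zev P x := (map_poly intr P).[x].

(** * Subrings of K, integral elements and saturation *)

Section Subrings.
Variable K : fieldExtType rat.
Implicit Types (O : K -> Prop) (x y z : K) (P : {poly int}).

Lemma intK_inj : injective (intr : int -> K).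
Proof.
move=> a b; rewrite -!(rmorph_int (in_alg K)) => /fmorph_inj.
exact: intr_inj.
Qed.

Lemma intK_eq0 (n : int) : ((n%:~R : K) == 0) = (n == 0).
Proof. by rewrite -(inj_eq intK_inj). Qed.

(** Predicates are [Prop]-valued because [ring_of_integers] and [in_Zadjoin] are existential
    statements, with no boolean form at hand. *)
Record is_subring O : Prop := IsSubring {
  subr_1 : O 1;
  subr_B : forall x y, O x -> O y -> O (x - y);
  subr_M : forall x y, O x -> O y -> O (x * y) }.

Section Closure.
Variables (O : K -> Prop) (OP : is_subring O).

Lemma subr_0 : O 0.
Proof. by rewrite -(subrr 1); apply: subr_B; case: OP. Qed.

Lemma subr_N x : O x -> O (- x).
Proof. by move=> Ox; rewrite -sub0r; apply: subr_B => //; apply: subr_0. Qed.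

Lemma subr_D x y : O x -> O y -> O (x + y).
Proof. by move=> Ox Oy; rewrite -[y]opprK; apply: subr_B => //; apply: subr_N. Qed.

Lemma subr_nat n : O n%:R.
Proof.
by elim: n => [|n IH]; [exact: subr_0 | rewrite mulrS; apply: subr_D; case: OP].
Qed.

Lemma subr_int (n : int) : O n%:~R.
Proof. by case: n => n; [|rewrite NegzE mulrNz; apply: subr_N]; exact: subr_nat. Qed.

Lemma subr_X x n : O x -> O (x ^+ n).
Proof.
move=> Ox; elim: n => [|n IH]; first by rewrite expr0; case: OP.
by rewrite exprS; apply: subr_M.
Qed.

Lemma subr_sum (I : Type) (s : seq I) (A : pred I) (F : I -> K) :
  (forall i, A i -> O (F i)) -> O (\sum_(i <- s | A i) F i).
Proof. by move=> H; elim/big_ind: _ => //; [exact: subr_0 | exact: subr_D]. Qed.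

Lemma subr_zev P x : O x -> O (zev P x).
Proof.
move=> Ox; rewrite horner_coef; apply: subr_sum => i _; rewrite coef_map /=.
by apply: (subr_M OP); [exact: subr_int | exact: subr_X].
Qed.
End Closure.

Lemma integer_subring : is_subring (@ring_of_integers K).
Proof.
split; first exact: integral1.
- by move=> x y; exact: integral_sub.
- by move=> x y; exact: integral_mul.
Qed.

Lemma Zadjoin_subring x : is_subring (in_Zadjoin x).
Proof.
split.
- by exists 1; rewrite rmorph1 hornerC.
- by move=> _ _ [p ->] [q ->]; exists (p - q); rewrite rmorphB hornerD hornerN.
- by move=> _ _ [p ->] [q ->]; exists (p * q); rewrite rmorphM hornerM.
Qed.

Lemma Zadjoin_self x : in_Zadjoin x x.
Proof. by exists 'X; rewrite map_polyX hornerX. Qed.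

Lemma Zadjoin_min O x y : is_subring O -> O x -> in_Zadjoin x y -> O y.
Proof. by move=> OP Ox [p ->]; exact: subr_zev. Qed.

(* Clear denominators in an equation of integral dependence of degree d. *)
Lemma integer_multiple_power O (p : int) z :
  is_subring O -> ring_of_integers z -> O (p%:~R * z) ->
  exists d, exists2 y, O y & (p%:~R * z) ^+ d = p%:~R * y.
Proof.
move=> OP [f mf /rootP fz0] Opz.
have Ez : z ^+ (size f).-1 = - \sum_(i < (size f).-1) (f`_i)%:~R * z ^+ i.
  move: fz0; rewrite horner_coef size_map_inj_poly ?rmorph0 //; last exact: intK_inj.
  have : f`_(size f).-1 = 1 by apply/eqP; rewrite -monicE.
  have : (0 < size f)%N by rewrite size_poly_gt0 monic_neq0.
  case: (size f) => // d _ /= fd; rewrite big_ord_recr /= coef_map /= fd mul1r.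
  rewrite addrC => /eqP; rewrite addr_eq0 => /eqP ->.
  by congr (- _); apply: eq_bigr => i _; rewrite coef_map.
set d := (size f).-1 in Ez *.
(* Multiplication by p^d turns the term f_i z^i into p times f_i p^(d-i-1) (p z)^i, since i < d. *)
exists d; exists (- \sum_(i < d) (f`_i * p ^+ (d - i.+1))%:~R * (p%:~R * z) ^+ i).
  apply: subr_N => //; apply: subr_sum => // i _.
  by apply: (subr_M OP); [exact: subr_int | exact: subr_X].
rewrite exprMn Ez !mulrN; congr (- _); rewrite !mulr_sumr; apply: eq_bigr => i _.
have -> : p%:~R ^+ d = p%:~R ^+ (d - i.+1) * p%:~R ^+ i.+1 :> K.
  by rewrite -exprD subnK.
rewrite exprS rmorphM /= rmorphXn /= exprMn; ring.
Qed.

Definition saturated_at O (p : int) : Prop :=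
  forall z, ring_of_integers z -> O (p%:~R * z) -> O z.

(** The prime factors of the denominator N are removed one by one. Saturation cancels a factor p
    other than q; a factor q is absorbed into x instead, and these collect in the power of q. It is
    applied with q = 3, the prime at which Z[theta] may fail to be saturated. *)
Lemma integers_in_order O (q : nat) x (N : int) :
  (forall p : nat, prime p -> p != q -> saturated_at O p) ->
  N != 0 -> ring_of_integers x -> O (N%:~R * x) ->
  is_subring O -> exists k, O ((q%:Z ^+ k)%:~R * x).
Proof.
move=> satO N0 ix ONx OP.
have {N0 ONx} [n n0 On] : exists2 n : nat, (0 < n)%N & O (n%:~R * x).
  exists `|N|%N; first by rewrite absz_gt0.
  case: (intP N) N0 ONx => // n _ H; rewrite abszN.
  by move/(subr_N OP): H; rewrite mulrNz mulNr opprK.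
elim/ltn_ind: n x ix n0 On => n IH x ix n0 On.
have [n1|n1] := eqVneq n 1%N.
  by exists 0; rewrite expr0; rewrite n1 in On.
have pr : prime (pdiv n) by apply: pdiv_prime; lia.
have dv : (pdiv n %| n)%N by exact: pdiv_dvd.
have p1 := prime_gt1 pr.
have nE : n = (n %/ pdiv n * pdiv n)%N by rewrite divnK.
have ltn : (n %/ pdiv n < n)%N by rewrite ltn_Pdiv.
have gt0 : (0 < n %/ pdiv n)%N by rewrite divn_gt0 (pdiv_gt0, pdiv_leq).
have [eqq|neq] := eqVneq (pdiv n) q.
  have [||k Ok] := IH _ ltn (q%:~R * x) _ gt0.
  - by apply: integral_mul => //; exact: (subr_int integer_subring).
  - by rewrite mulrA -rmorphM /= -eqq -PoszM -nE.
  by exists k.+1; rewrite exprSr rmorphM /= -mulrA.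
apply: (IH _ ltn) => //; apply: (satO _ pr neq).
  by apply: integral_mul => //; exact: (subr_int integer_subring).
by rewrite mulrA -rmorphM /= -PoszM mulnC -nE.
Qed.

Lemma saturated_pow O (p : int) x k :
  saturated_at O p -> ring_of_integers x -> O ((p ^+ k)%:~R * x) -> O x.
Proof.
move=> satO ix; elim: k => [|k IH]; first by rewrite expr0 mul1r.
rewrite exprS rmorphM /= -mulrA => H; apply/IH/satO => //.
by apply: integral_mul => //; exact: (subr_int integer_subring).
Qed.
End Subrings.

(** * Irreducibility of X^6 - m *)

Lemma zevD (R : comNzRingType) (P Q : {poly int}) (x : R) :
  zev (P + Q) x = zev P x + zev Q x.
Proof. by rewrite rmorphD hornerD. Qed.

Lemma zevB (R : comNzRingType) (P Q : {poly int}) (x : R) :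
  zev (P - Q) x = zev P x - zev Q x.
Proof. by rewrite rmorphB hornerD hornerN. Qed.

Lemma zevM (R : comNzRingType) (P Q : {poly int}) (x : R) :
  zev (P * Q) x = zev P x * zev Q x.
Proof. by rewrite rmorphM hornerM. Qed.

Lemma zevXn (R : comNzRingType) (P : {poly int}) n (x : R) :
  zev (P ^+ n) x = zev P x ^+ n.
Proof. by rewrite rmorphXn horner_exp. Qed.

Lemma zevC (R : comNzRingType) (n : int) (x : R) : zev n%:P x = n%:~R.
Proof. by rewrite map_polyC hornerC. Qed.

Lemma zevX (R : comNzRingType) (x : R) : zev 'X x = x.
Proof. by rewrite map_polyX hornerX. Qed.

Definition zevE := (zevB, zevD, zevXn, zevM, zevC, zevX).

Lemma zev_rmorph (R S : comNzRingType) (i : {rmorphism R -> S}) (P : {poly int}) (x : R) :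
  i (zev P x) = zev P (i x).
Proof.
rewrite -horner_map /= -map_poly_comp; congr (_.[_]).
by apply: eq_map_poly => n /=; rewrite rmorph_int.
Qed.

Section SixthRoot.
Variable m : int.
Hypotheses (hsf : squarefreez m) (hm0 : m <> 0) (hm1 : m <> 1) (hmN1 : m <> -1).

Local Notation f := ('X^6 - m%:P : {poly int}).

Lemma sixth_monic : f \is monic.
Proof. by rewrite monicXnsubC. Qed.

Lemma squarefree_prime_dvd (p : nat) : prime p -> ~~ ((p ^ 2)%N %| m)%Z.
Proof.
move=> pp; apply/negP => H.
have : (p%:Z ^+ 2 %| m)%Z by move: H; rewrite !dvdzE.
by move/hsf; case: p pp {H} => [|[|p]].
Qed.

(** Eisenstein's criterion at the smallest prime divisor of m, which exists since |m| > 1 and whose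
    square does not divide the square-free m. *)
Lemma sixth_irreducible : irreducible_poly (map_poly intr f : {poly rat}).
Proof.
apply/irreducible_rat_int.
have m2 : (1 < `|m|)%N by case: m hm0 hm1 hmN1 => [[|[|n]]|[|n]].
have pp := pdiv_prime m2; set p := pdiv _ in pp.
have pm : (p%:Z %| m)%Z by rewrite dvdzE /= pdiv_dvd.
have sf : size f = 7%N by rewrite size_XnsubC.
apply: (eisenstein_crit pp); rewrite ?sf //.
- rewrite (monicP sixth_monic); apply/negP; rewrite dvdzE /= dvdn1 => /eqP p1.
  by rewrite p1 in pp.
- rewrite coefB coefXn coefC /= sub0r dvdzE abszN -dvdzE; exact: squarefree_prime_dvd.
move=> i i6; rewrite coefB coefXn coefC; move: i6.
by case: i => [|i] i6 /=; rewrite ?(ltn_eqF i6) ?subr0 ?dvdz0 // sub0r dvdzE abszN -dvdzE.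
Qed.

Section Field.
Variables (F : fieldType) (i : {rmorphism rat -> F}) (x : F).
Hypothesis (hx : x ^+ 6 = m%:~R).

Lemma sixth_zev : zev f x = 0.
Proof. by rewrite !zevE hx subrr. Qed.

(** A nonzero P of degree at most 5 is coprime over Q to the irreducible X^6 - m; the Bezout
    relation, carried to F by [i], would evaluate to 0 = 1 at x. *)
Lemma small_zev_eq0 (P : {poly int}) : (size P <= 6)%N -> zev P x = 0 -> P = 0.
Proof.
move=> sP Px; apply/eqP/negPn/negP => P0.
have Q0 : map_poly intr P != 0 :> {poly rat} by rewrite map_poly_eq0_id0
  // intr_eq0 lead_coef_eq0.
have : coprimep (map_poly intr f) (map_poly intr P : {poly rat}).
  rewrite irreducible_poly_coprime; last exact: sixth_irreducible.
  apply/negP => /(dvdp_leq Q0); rewrite !size_map_inj_poly ?rmorph0 //; try exact: intr_inj.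
  by rewrite size_XnsubC // leqNgt ltnS sP.
case/Bezout_eq1_coprimepP => [[u v]] /(congr1 (fun q => (map_poly i q).[x])) /=.
have Emap Q : map_poly i (map_poly intr Q) = map_poly intr Q.
  by rewrite -map_poly_comp; apply: eq_map_poly => n /=; rewrite rmorph_int.
have : (map_poly i (map_poly intr f)).[x] = 0 by rewrite Emap sixth_zev.
have : (map_poly i (map_poly intr P)).[x] = 0 by rewrite Emap.
move: (map_poly _ f) (map_poly _ P) => p q q0 p0.
rewrite rmorphD !rmorphM rmorph1 hornerD !hornerM p0 q0 !mulr0 addr0 hornerC.
by move/esym/eqP; rewrite oner_eq0.
Qed.

(** Division by the monic X^6 - m stays over Z, and the remainder, of degree at most 5, vanishes at
    x. *)
Lemma zev_sixth_dvd (P : {poly int}) : zev P x = 0 -> exists Q, P = Q * f.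
Proof.
move=> Px; have E := Pdiv.RingMonic.rdivp_eq sixth_monic P.
suff r0 : Pdiv.Ring.rmodp P f = 0 by exists (Pdiv.Ring.rdivp P f); rewrite {1}E r0 addr0.
apply: small_zev_eq0.
  by rewrite -ltnS -(size_XnsubC m (isT : 0 < 6)%N) Pdiv.Ring.ltn_rmodpN0 ?monic_neq0
    ?sixth_monic.
by move: Px; rewrite {1}E zevD zevM sixth_zev mulr0 add0r.
Qed.

(** This is what makes the embeddings of K well defined: a relation at one sixth root of m holds at
    all of them. *)
Lemma zev_sixth_transfer (R : comNzRingType) (y : R) (P : {poly int}) :
  y ^+ 6 = m%:~R -> zev P x = 0 -> zev P y = 0.
Proof.
by move=> hy /zev_sixth_dvd[Q ->]; rewrite zevM !zevE hy subrr mulr0.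
Qed.
End Field.
End SixthRoot.

(** * Dedekind's criterion *)

(** By separability the cofactor of gcd(p, q) in p is coprime to this gcd, hence to q; as it divides
    q^n, it is constant. *)
Lemma separable_dvd_exp (F : fieldType) (p q : {poly F}) n :
  separable_poly p -> p %| q ^+ n -> p %| q.
Proof.
move=> sp pq; have p0 := separable_poly_neq0 sp.
have E : p = (p %/ gcdp p q) * gcdp p q by rewrite divpK ?dvdp_gcdl.
set g := gcdp p q in E; set r := p %/ g in E.
have cop : coprimep r g by apply: (separable_coprime sp); rewrite -E.
have crq : coprimep r q.
  apply/coprimepP => d dr dq.
  have dg : d %| g by rewrite dvdp_gcd dq (dvdp_trans dr) // E dvdp_mulr.
  by move/coprimepP: cop; apply.
have : coprimep r r.
  have rq : r %| q ^+ n by rewrite (dvdp_trans _ pq) // [X in _ %| X]E dvdp_mulr.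
  have : coprimep r (q ^+ n) by rewrite coprimep_expr.
  by apply: coprimep_dvdl.
rewrite coprimepp => /eqP s1; have /size_poly1P[c c0 rc] : size r == 1%N by rewrite s1.
by rewrite E rc mul_polyC dvdpZl // dvdp_gcdr.
Qed.

Section Reduction.
Variables (p : nat) (pp : prime p).
Local Notation red := (map_poly (intr : int -> 'F_p)).

Lemma Fp_intr_eq0 (n : int) : ((n%:~R : 'F_p) == 0) = (p%:Z %| n)%Z.
Proof. by rewrite (dvdz_pcharf (pchar_Fp pp)). Qed.

Lemma red_eq0 (P : {poly int}) : red P = 0 -> exists Q, P = p%:Z%:P * Q.
Proof.
move=> P0; exists (\poly_(i < size P) (P`_i %/ p)%Z); apply/polyP => i.
rewrite coefCM coef_poly; case: ltnP => [iP|iP]; last by rewrite nth_default // mulr0.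
have : (red P)`_i = 0 by rewrite P0 coef0.
by rewrite coef_map /= => /eqP; rewrite Fp_intr_eq0 mulrC => /divzK ->.
Qed.

Lemma red_surj (Q : {poly 'F_p}) : exists P, red P = Q.
Proof.
exists (\poly_(i < size Q) ((Q`_i)%R : nat)%:Z); apply/polyP => i.
rewrite coef_map coef_poly /=; case: ltnP => iQ; last by rewrite nth_default // rmorph0.
exact: natr_Zp.
Qed.

Lemma red_dvd (P Q : {poly int}) : red P %| red Q ->
  exists A B, Q = P * A + p%:Z%:P * B.
Proof.
case/dvdpP => A'; have [A <-] := red_surj A' => E.
have [|B EB] := @red_eq0 (Q - P * A); first by rewrite rmorphB rmorphM /= E mulrC subrr.
by exists A, B; rewrite -EB addrC subrK.
Qed.
End Reduction.

Section Dedekind.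
Variables (K : fieldExtType rat) (theta : K) (f : {poly int}).
Hypotheses (f_theta : zev f theta = 0)
  (f_dvd : forall P, zev P theta = 0 -> exists Q, P = Q * f).
Hypothesis theta_int : ring_of_integers theta.
Variables (p : nat) (pp : prime p) (phi h : {poly int}) (e : nat).
Local Notation red := (map_poly (intr : int -> 'F_p)).
Hypotheses (f_eq : f = phi ^+ e + p%:Z%:P * h) (e_gt0 : (0 < e)%N)
  (sep : separable_poly (red phi)) (cop : coprimep (red phi) (red h)).

Lemma red_prime : red p%:Z%:P = 0.
Proof. by rewrite map_polyC /=; apply/eqP; rewrite polyC_eq0 Fp_intr_eq0. Qed.

(** Integrality of z gives P(theta)^d in p Z[theta] for some d. Modulo p, P^d is then a multiple of
    f = phi^e, so the separable [phi] divides P. *)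
Lemma integer_red_dvd z P : ring_of_integers z -> zev P theta = p%:Z%:~R * z ->
  red phi %| red P.
Proof.
move=> iz E.
have [|d [_ [Y ->]]] := integer_multiple_power (Zadjoin_subring theta) iz (p := p).
  by exists P.
rewrite -E => E2; have [|Q EQ] := f_dvd (P := P ^+ d - p%:Z%:P * Y).
  by rewrite zevB zevXn zevM zevC E2 subrr.
have : red (P ^+ d) = red (Q * f).
  by rewrite -EQ rmorphB (rmorphM _ _ Y) /= red_prime mul0r subr0.
rewrite f_eq !rmorphM rmorphD rmorphXn (rmorphM _ _ h) /= red_prime mul0r addr0 rmorphXn /=
  => EE.
apply: (separable_dvd_exp (n := d) sep); rewrite EE dvdp_mull // dvdp_exp //.
Qed.

(** By induction on j up to e, p z lies in phi(theta)^j Z[theta] + p Z[theta]. At j = e,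
    phi(theta)^e = - p h(theta), and p cancels. *)
Lemma Dedekind z : ring_of_integers z ->
  in_Zadjoin theta (p%:Z%:~R * z) -> in_Zadjoin theta z.
Proof.
move=> iz [P0 EP0].
have p0 : (p%:Z%:~R : K) != 0 by rewrite intK_eq0; have := prime_gt0 pp; lia.
have phi_e : zev phi theta ^+ e = - (p%:Z%:~R * zev h theta).
  by apply/eqP; rewrite -addr_eq0 -f_theta f_eq !zevE.
have ievP P : ring_of_integers (zev P theta) by apply: subr_zev => //; exact: integer_subring.
have step : forall j, (j <= e)%N ->
    exists A B, p%:Z%:~R * z = zev phi theta ^+ j * zev A theta + p%:Z%:~R * zev B theta.
  elim=> [|j IH] je; first by exists P0, 0; rewrite EP0 rmorph0 hornerC; ring.
  have [A [B E]] := IH (ltnW je).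
  (* The e-th power of w is integral, and phi^e = - p h clears all but one
     factor p of its denominator; hence phi divides A modulo p. *)
  pose w := (z - zev B theta) * zev phi theta ^+ (e.-1 - j).
  have iw : ring_of_integers w.
    apply: (subr_M (integer_subring K)); first by apply: (subr_B (integer_subring K)).

    by apply: (subr_X (integer_subring K)).
  have Ew : p%:Z%:~R * w = zev phi theta ^+ e.-1 * zev A theta.
    rewrite /w mulrA mulrBr E addrK.
    rewrite -mulrA [zev A theta * _]mulrC mulrA -exprD subnKC //; lia.
  have Ewe : zev ((- h) ^+ e.-1 * A ^+ e) theta = p%:Z%:~R * w ^+ e.
    apply: (mulfI (expf_neq0 e.-1 p0)).
    rewrite mulrA -exprSr prednK // -exprMn Ew exprMn -exprM mulnC exprM phi_e.
    by rewrite zevM !zevXn rmorphN hornerN mulrA -mulrN exprMn.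
  have := integer_red_dvd (subr_X (integer_subring K) e iw) Ewe.
  rewrite rmorphM !rmorphXn rmorphN => dv.
  have : red phi %| red A ^+ e.
    move: dv; rewrite Gauss_dvdpr // coprimep_expr //.
    by rewrite -scaleN1r coprimepZr // oppr_eq0 oner_eq0.
  move/(separable_dvd_exp sep)/(red_dvd pp) => [A' [B' EA]].
  exists A', (phi ^+ j * B' + B).
  rewrite E EA !zevE exprSr; ring.
have [A [B E]] := step _ (leqnn e).
exists (B - h * A); apply: (mulfI p0); rewrite E phi_e !zevE; ring.
Qed.
End Dedekind.

(** A Bezout identity over Z may have any constant c on the right, as long as c becomes invertible
    modulo p. *)
Lemma red_coprime p (u v a b : {poly int}) (c : int) : prime p ->
  a * u + b * v = c%:P -> ~~ (p%:Z %| c)%Z ->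
  coprimep (map_poly (intr : int -> 'F_p) u) (map_poly intr v).
Proof.
move=> pp E c0; have c0' : (c%:~R : 'F_p) != 0 by rewrite Fp_intr_eq0.
apply/Bezout_eq1_coprimepP.
exists ((c%:~R^-1)%:P * map_poly intr a, (c%:~R^-1)%:P * map_poly intr b) => /=.
by rewrite -!mulrA -mulrDr -!rmorphM -rmorphD E /= map_polyC /= -polyCM mulVf.
Qed.

Lemma red_separable p (u a b : {poly int}) (c : int) : prime p ->
  a * u + b * u^`() = c%:P -> ~~ (p%:Z %| c)%Z ->
  separable_poly (map_poly (intr : int -> 'F_p) u).
Proof. by move=> pp E c0; rewrite unlock deriv_map; exact: red_coprime E c0. Qed.

(** * Saturation of Z[theta] prime by prime *)

Section PureSextic.
Variables (m : int) (K : fieldExtType rat) (theta : K).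
Hypotheses (hsf : squarefreez m) (hm0 : m <> 0) (hm1 : m <> 1) (hmN1 : m <> -1).
Hypotheses (htheta : theta ^+ 6 = m%:~R) (hK : <<1%VS; theta>>%VS = {:K}%VS).

Local Notation f := ('X^6 - m%:P : {poly int}).

Lemma theta_integer : ring_of_integers theta.
Proof.
exists f; first exact: sixth_monic.
by apply/rootP; rewrite !zevE htheta subrr.
Qed.

Lemma Zadjoin_integer x : in_Zadjoin theta x -> ring_of_integers x.
Proof. by apply: Zadjoin_min theta_integer; exact: integer_subring. Qed.

Lemma multiple_in_Zadjoin (x : K) : exists2 N : int, N != 0 & in_Zadjoin theta (N%:~R * x).
Proof.
have /Fadjoin1_polyP[q ->] : x \in <<1; theta>>%VS by rewrite hK memvf.
have [P [a a0 ->]] := rat_poly_scale q; exists a => //; exists P.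
have ai : a%:~R * in_alg K a%:~R^-1 = 1.
  by rewrite -(rmorph_int (in_alg K)) -rmorphM divff ?intr_eq0 // rmorph1.
rewrite map_polyZ hornerZ mulrA ai mul1r -map_poly_comp.
by congr (_.[_]); apply: eq_map_poly => n /=; rewrite -(rmorph_int (in_alg K)).
Qed.

Let Ded p (pp : prime p) phi h e :=
  @Dedekind K theta f (sixth_zev htheta)
   (zev_sixth_dvd hsf hm0 hm1 hmN1 (in_alg K) htheta) theta_integer p pp phi h e.

(** Modulo p the polynomial is X^6, and - m / p is a unit modulo p because m is square-free. *)
Lemma saturated_ramified (p : nat) : prime p -> (p%:Z %| m)%Z ->
  saturated_at (in_Zadjoin theta) p.
Proof.
move=> pp pm z; apply: (Ded (phi := 'X) (h := (- (m %/ p)%Z)%:P) (e := 6) pp) => //.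
- by rewrite -polyCM mulrN mulrC divzK // polyCN.
- apply: (red_separable (a := 0) (b := 1) (c := 1)) => //; first by rewrite derivX; ring.
  by rewrite dvdzE /= dvdn1; case: (p) pp => [|[|]].
apply: (red_coprime (a := 0) (b := 1) (c := - (m %/ p)%Z)) => //; first by ring.
apply: contraNN (squarefree_prime_dvd hsf pp); rewrite dvdzE abszN -dvdzE => /dvdzP[q Eq].
apply/dvdzP; exists q; rewrite -{1}(divzK pm) Eq; lia.
Qed.

(** With m = 2 c - 1, X^6 - m = (X^3 - 1)^2 + 2 (X^3 - c). The two cubics differ by 1 - c, which is
    odd since m = 3 (mod 4) makes c even. *)
Lemma saturated_2 : (m %% 4 == 3)%Z -> saturated_at (in_Zadjoin theta) 2%:Z.
Proof.
move=> m3 z; pose c := ((m + 1) %/ 2)%Z.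
have Em : m = 2 * c - 1 by rewrite /c; lia.
apply: (Ded (phi := 'X^3 - 1) (h := 'X^3 - c%:P) (e := 2) (isT : prime 2)) => //.
- by rewrite [m in LHS]Em; ring.
- by apply: (red_separable (a := -3%:P) (b := 'X) (c := 3)) => //;
  rewrite derivB derivXn derivC; ring.
apply: (red_coprime (a := - 1) (b := 1) (c := 1 - c)) => //; first by ring.
by rewrite /c; lia.
Qed.

(** As m^3 = m (mod 3), X^6 - m is the cube of X^2 - m modulo 3. Modulo X^2 - m, the cofactor [h] of
    3 reduces to the constant (m^3 - m) / 3, which is prime to 3 by hypothesis. *)
Lemma saturated_3 : ~~ (3 %| m)%Z -> ~~ (9 %| m ^+ 3 - m)%Z ->
  saturated_at (in_Zadjoin theta) 3%:Z.
Proof.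
move=> m3 m9 z; pose c := ((m ^+ 3 - m) %/ 3)%Z.
have m33 : (3 %| m ^+ 3 - m)%Z.
  have := divz_eq m 3; move: (m %/ 3)%Z => k E.
  have [r1|r2] : (m %% 3 = 1 \/ m %% 3 = 2)%Z by lia.
    by apply/dvdzP; exists (9 * k ^+ 3 + 9 * k ^+ 2 + 2 * k); rewrite {}E r1; ring.
  by apply/dvdzP; exists (9 * k ^+ 3 + 18 * k ^+ 2 + 11 * k + 2); rewrite {}E r2; ring.
have Em : m ^+ 3 - m = 3 * c by rewrite mulrC divzK.
apply: (Ded (phi := 'X^2 - m%:P) (h := m%:P * 'X^4 - (m ^+ 2)%:P * 'X^2
  + c%:P) (e := 3) (isT : prime 3)) => //.
- have -> : f = 'X^6 - ((m ^+ 3)%:P - 3%:P * c%:P).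
    by rewrite -polyCM -Em -polyCB; congr (_ - _ %:P); ring.
  by ring.
- apply: (red_separable (a := -2%:P) (b := 'X) (c := 2 * m)) => //;
  first by rewrite derivB derivXn derivC; ring.
  by lia.
apply: (red_coprime (a := - m%:P * 'X^2) (b := 1) (c := c)) => //; first by ring.
by apply: contraNN m9 => /dvdzP[q Eq]; apply/dvdzP; exists q; rewrite Em Eq; ring.
Qed.

(** Here X^6 - m is separable modulo p. Shifting it by p gives the shape phi + p h with [h] = 1,
    coprime to everything. *)
Lemma saturated_unramified (p : nat) : prime p -> ~~ (p%:Z %| 6 * m)%Z ->
  saturated_at (in_Zadjoin theta) p.
Proof.
move=> pp pm z.
apply: (Ded (phi := f - p%:Z%:P) (h := 1) (e := 1) pp) => //.
- by ring.
- apply: (red_separable (a := -6%:P) (b := 'X) (c := 6 * (m + p))) => //.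
    by rewrite !derivB derivXn !derivC; ring.
  by apply: contraNN pm => /dvdzP[q Eq]; apply/dvdzP; exists (q - 6); lia.
apply: (red_coprime (a := 0) (b := 1) (c := 1)) => //; first by ring.
by rewrite dvdzE /= dvdn1; case: (p) pp => [|[|]].
Qed.

(** The hypothesis on 4 says that m = 2, 3 (mod 4): either 2 divides m, or [saturated_2] applies. *)
Lemma saturated_away_from_3 (p : nat) : ~~ (4 %| m * (m - 1))%Z -> prime p -> p != 3 ->
  saturated_at (in_Zadjoin theta) p.
Proof.
move=> m4 pp p3; have [pm|pm] := boolP (p%:Z %| m)%Z; first exact: saturated_ramified.
have [p2|p2] := eqVneq p 2%N.
  by rewrite p2 in pm *; apply: saturated_2; have := divz_eq m 4; nia.
apply: saturated_unramified => //; rewrite dvdzE abszM Euclid_dvdM // negb_or -!dvdzE pm andbT.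
rewrite dvdzE /= (Euclid_dvdM 2 3) // !dvdn_prime2 // negb_or p2 p3 //.
Qed.

Lemma Zadjoin_theta_monogenic : ~~ (4 %| m * (m - 1))%Z -> ~~ (9 %| m ^+ 2 - 1)%Z ->
  monogenic K.
Proof.
move=> m4 m9; exists theta; split; first exact: theta_integer.
move=> x; split; last exact: Zadjoin_integer.
move=> ix; have [N N0 xN] := multiple_in_Zadjoin x.
have [|k xk] := integers_in_order (q := 3) _ N0 ix xN (Zadjoin_subring theta).
  by move=> p; exact: saturated_away_from_3.
apply: saturated_pow ix xk.
have [m3|m3] := boolP (3 %| m)%Z; first exact: (@saturated_ramified 3).
apply: saturated_3 => //; apply: contraNN m9.
have -> : m ^+ 3 - m = m * (m ^+ 2 - 1) by ring.
by rewrite Gauss_dvdzr // (@coprimez_pexpl 2 3 m isT) coprimezE prime_coprime.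
Qed.
End PureSextic.

(** * The case m = 1 (mod 4) *)

Ltac subr_tac OP := repeat first
  [ assumption | exact: (subr_nat OP) | exact: (subr_int OP) | exact: (subr_1 OP)
  | apply: (subr_X OP) | apply: (subr_N OP) | apply: (subr_D OP) | apply: (subr_M OP) ].

(** * Ideals modulo which every element satisfies x^q = x *)

Section FrobeniusFixed.
Variables (K : fieldExtType rat) (O J : K -> Prop).
Hypothesis OP : is_subring O.
Hypotheses (JD : forall x y, J x -> J y -> J (x + y))
  (JM : forall x y, O x -> J y -> J (x * y)).
Variable q : nat.

(** The q-th power map is multiplicative, and additive modulo J by hypothesis, so x^q = x (mod J)
    need only be checked on ring generators. *)
Lemma frobenius_fixed_subring :
  (forall x y, O x -> O y -> J ((x - y) ^+ q - (x ^+ q - y ^+ q))) -> J 0 ->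
  is_subring (fun x => O x /\ J (x ^+ q - x)).
Proof.
move=> JB J0; split.
- by split; [exact: subr_1 | rewrite expr1n subrr].
- move=> x y [Ox Jx] [Oy Jy]; split; first exact: subr_B.
  have -> : (x - y) ^+ q - (x - y) = ((x - y) ^+ q - (x ^+ q - y ^+ q))
      + ((x ^+ q - x) + (-1) * (y ^+ q - y)) by ring.
  apply: JD; first exact: JB.
  apply: JD => //; apply: JM => //; apply: subr_N => //; exact: subr_1.
- move=> x y [Ox Jx] [Oy Jy]; split; first exact: subr_M.
  rewrite exprMn.
  have -> : x ^+ q * y ^+ q - x * y = x ^+ q * (y ^+ q - y) + y * (x ^+ q - x) by ring.
  by apply: JD; apply: JM => //; apply: subr_X.
Qed.

(** Such a J is a radical ideal: iteration gives x = x^(q^k) (mod J) for all k, and x^(q^d) is a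
    multiple of x^d because q^d >= d. *)
Lemma frobenius_fixed_radical x d : (1 < q)%N -> O x ->
  (forall y, O y -> J (y ^+ q - y)) -> J 0 -> J (x ^+ d) -> J x.
Proof.
move=> q1 Ox Jq J0 Jd.
have Jk k : J (x - x ^+ (q ^ k)).
  elim: k => [|k IH]; first by rewrite expn0 expr1 subrr.
  have -> : x - x ^+ (q ^ k.+1)
    = (x - x ^+ (q ^ k)) + (-1) * ((x ^+ (q ^ k)) ^+ q - x ^+ (q ^ k)).
    by rewrite expnSr exprM; ring.
  apply: JD => //; apply: JM; first by apply: subr_N => //; exact: subr_1.
  by apply: Jq; exact: subr_X.
have dq : (d <= q ^ d)%N by apply/ltnW/ltn_expl.
rewrite -[x](subrK (x ^+ (q ^ d))); apply: JD => //.
by rewrite -(subnK dq) exprD; apply: JM => //; exact: subr_X.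
Qed.
End FrobeniusFixed.

Section Multiples.
Variables (K : fieldExtType rat) (O : K -> Prop) (n : int).
Hypothesis OP : is_subring O.
Definition multiple_of x := exists2 y, O y & x = n%:~R * y.

Lemma multiple0 : multiple_of 0.
Proof. by exists 0; [exact: subr_0 | rewrite mulr0]. Qed.

Lemma multipleD x y : multiple_of x -> multiple_of y -> multiple_of (x + y).
Proof. by move=> [a Oa ->] [b Ob ->]; exists (a + b); [exact: subr_D | rewrite mulrDr]. Qed.

Lemma multipleM x y : O x -> multiple_of y -> multiple_of (x * y).
Proof. by move=> Ox [b Ob ->]; exists (x * b); [exact: subr_M | rewrite mulrCA]. Qed.
End Multiples.

(** Gauss's lemma: the rational minimal polynomial is proportional to an integral factor of a monic
    integral polynomial, and that factor has leading coefficient +-1. *)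
Lemma integral_minpoly (K : fieldExtType rat) (x : K) : ring_of_integers x ->
  exists g : {poly int}, [/\ g \is monic, zev g x = 0, size g = (adjoin_degree 1 x).+1 &
    forall P, zev P x = 0 -> exists Q, P = Q * g].
Proof.
move=> [g0 mg0 gx0].
have Emap (Q : {poly int}) : map_poly (in_alg K) (map_poly intr Q) = map_poly intr Q.
  by rewrite -map_poly_comp; apply: eq_map_poly => n /=; rewrite -(rmorph_int (in_alg K)).
have over1 (Q : {poly int}) : map_poly intr Q \is a polyOver (1%AS : {subfield K}).
  by rewrite -Emap; apply/polyOver1P; exists (map_poly intr Q).
have [q Eq] := polyOver1P (minPolyOver 1 x).
have mq : q \is monic by rewrite -(map_monic (in_alg K)) -Eq monic_minPoly.
have qdvd Q : zev Q x = 0 -> q %| map_poly intr Q.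
  by move=> Qx; rewrite -(dvdp_map (in_alg K)) Emap -Eq; apply: minPoly_dvdp => //; apply/rootP.
have sq : size q = (adjoin_degree 1 x).+1
  by rewrite -(size_map_poly (in_alg K)) -Eq size_minPoly.
have [p1 [a a0 Ep] [r Er]] := dvdpP_rat_int (qdvd _ (rootP gx0)).
have u : lead_coef p1 * lead_coef r = 1 by rewrite -lead_coefM -Er; apply/monicP.
have uu : lead_coef p1 * lead_coef p1 = 1.
  have : lead_coef p1 \is a GRing.unit by apply/unitrPr; exists (lead_coef r).
  by case/orP => /eqP ->.
pose g := lead_coef p1 *: p1.
have p10 : p1 != 0 by rewrite -lead_coef_eq0; apply/eqP => z; rewrite z mul0r in uu.
have mg : g \is monic by rewrite monicE /g lead_coefZ uu.
have sg : size g = (adjoin_degree 1 x).+1.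
  rewrite -sq Ep (size_scale _ a0) size_map_inj_poly ?rmorph0 //; last exact: intr_inj.
  by rewrite size_scale // lead_coef_eq0.
have gx : zev g x = 0.
  have : root (map_poly (in_alg K) q) x by rewrite -Eq root_minPoly.
  rewrite Ep map_polyZ Emap /root hornerZ mulf_eq0 fmorph_eq0 (negPf a0) /= => /eqP p1x.
  by rewrite /g -mul_polyC zevM p1x mulr0.
exists g; split => // P Px.
have E := Pdiv.RingMonic.rdivp_eq mg P.
have rx : zev (Pdiv.Ring.rmodp P g) x = 0.
  by move: Px; rewrite {1}E zevD zevM gx mulr0 add0r.
exists (Pdiv.Ring.rdivp P g); rewrite {1}E.
suff -> : Pdiv.Ring.rmodp P g = 0 by rewrite addr0.
apply/eqP/negPn/negP => r0.
have : (size q <= size (Pdiv.Ring.rmodp P g))%N.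
  rewrite -(size_map_inj_poly (f := intr : int -> rat)) ?rmorph0 //; last exact: intr_inj.
  apply: dvdp_leq (qdvd _ rx); rewrite map_poly_eq0_id0 //.
  by rewrite intr_eq0 lead_coef_eq0.
by rewrite sq -sg leqNgt Pdiv.Ring.ltn_rmodpN0 // monic_neq0.
Qed.

Lemma int_odd_part (N : int) : N != 0 -> exists j k, N = 2 ^+ k * (2 * j + 1).
Proof.
have [n] := ubnP `|N|%N; elim: n N => // n IH N Nn N0.
have [j [->|EN]] : exists j, N = 2 * j + 1 \/ N = 2 * j.
- by exists (N %/ 2)%Z; lia.
- by exists j, 0; rewrite expr0 mul1r.
have [||j' [k E]] := IH j; try lia.
by exists j', k.+1; rewrite EN E exprS mulrA.
Qed.

(** * The order at 2 and the failure of monogenicity *)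

Section OneModFour.
Variables (m : int) (K : fieldExtType rat) (theta : K).
Hypotheses (hsf : squarefreez m) (hm0 : m <> 0) (hm1 : m <> 1) (hmN1 : m <> -1).
Hypotheses (htheta : theta ^+ 6 = m%:~R) (hK : <<1%VS; theta>>%VS = {:K}%VS).

(** Since x generates K, it has the degree of [theta], whose minimal polynomial cannot have degree
    at most 5 by [small_zev_eq0]. *)
Lemma generator_degree (x : K) : in_Zadjoin x theta -> (6 <= adjoin_degree 1 x)%N.
Proof.
move=> [P EP].
have -> : adjoin_degree 1 x = adjoin_degree 1 theta.
  rewrite !adjoin_degreeE hK; congr (divn (\dim _) _); apply/eqP; rewrite eqEsubv subvf /= -hK.
  apply/FadjoinP; split; first exact: sub1v.
  by rewrite EP; apply: mempx_Fadjoin; apply/polyOverP => i; rewrite coef_map /= rpred_int.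
have [g [mg gt sg _]] := integral_minpoly (theta_integer htheta).
rewrite -ltnS -sg ltnNge; apply/negP => g6.
have := monic_neq0 mg.
by rewrite (small_zev_eq0 hsf hm0 hm1 hmN1 (in_alg K) htheta g6 gt) eqxx.
Qed.

Hypothesis m14 : (4 %| m - 1)%Z.
Let c : int := ((m - 1) %/ 4)%Z.
Let delta : K := (1 + theta ^+ 3) / 2%:R.

Lemma two_neq0 : (2%:R : K) != 0.
Proof. by rewrite (intK_eq0 K 2). Qed.

Lemma delta_sq : delta ^+ 2 = delta + c%:~R.
Proof.
have E : theta ^+ 6 = 4%:R * c%:~R + 1.
  rewrite htheta -{1}[m](subrK 1) -(divzK m14) -/c rmorphD rmorphM /=; ring.
rewrite /delta; field : E; exact: two_neq0.
Qed.

Lemma theta3_delta : theta ^+ 3 = 2%:R * delta - 1.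
Proof. by rewrite /delta; field; exact: two_neq0. Qed.

Definition order2 (x : K) : Prop := exists P Q, x = zev P theta + zev Q theta * delta.

Lemma order2_subring : is_subring order2.
Proof.
split.
- by exists 1, 0; rewrite rmorph1 rmorph0 !hornerC mul0r addr0.
- by move=> _ _ [P [Q ->]] [P' [Q' ->]]; exists (P - P'), (Q - Q'); rewrite !zevE; ring.
move=> _ _ [P [Q ->]] [P' [Q' ->]].
exists (P * P' + Q * Q' * c%:P), (P * Q' + Q * P' + Q * Q'); rewrite !zevE.
have := delta_sq; move: delta (zev P _) (zev Q _) (zev P' _) (zev Q' _) => d p q p' q' E.
by ring : E.
Qed.

Lemma order2_Zadjoin x : in_Zadjoin theta x -> order2 x.
Proof. by move=> [P ->]; exists P, 0; rewrite rmorph0 hornerC mul0r addr0. Qed.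

Lemma delta_integer : ring_of_integers delta.
Proof.
exists ('X^2 - 'X - c%:P).
  rewrite -addrA -opprD monicE lead_coefDl ?lead_coefXn // size_polyXn size_polyN.
  by rewrite ltnS (leq_trans (size_polyD _ _)) // size_polyX size_polyC; case: (c != 0).
by apply/rootP; rewrite !zevE delta_sq; ring.
Qed.

Lemma order2_integer x : order2 x -> ring_of_integers x.
Proof.
have zi P : ring_of_integers (zev P theta).
  by apply: subr_zev; [exact: integer_subring | exact: theta_integer htheta].
move=> [P [Q ->]]; apply: (subr_D (integer_subring K)) => //.
by apply: (subr_M (integer_subring K)) => //; exact: delta_integer.
Qed.

(** The fourth power is additive modulo 2, so two generators suffice: theta^4 - theta = 2 theta
    (delta - 1), and delta^4 - delta = 2 c delta + c^2 + c with c^2 + c even. *)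
Lemma order2_frobenius x : order2 x -> multiple_of order2 2 (x ^+ 4 - x).
Proof.
have OP := order2_subring.
have SP : is_subring (fun x => order2 x /\ multiple_of order2 2 (x ^+ 4 - x)).
  apply: frobenius_fixed_subring => //.
  - exact: multipleD.
  - exact: multipleM.
  - move=> {}x y Ox Oy.
    exists (y ^+ 4 + 3%:R * (x ^+ 2 * y ^+ 2) - 2%:R * (x ^+ 3 * y + x * y ^+ 3)); last by ring.
    by subr_tac OP.
  - exact: multiple0.
move=> [P [Q ->]]; suff [] : order2 (zev P theta + zev Q theta * delta) /\
  multiple_of order2 2 ((zev P theta + zev Q theta * delta) ^+ 4 - (zev P theta + zev Q theta
    * delta)) by [].
have Ot : order2 theta by apply: order2_Zadjoin; exact: Zadjoin_self.
have Od : order2 delta by exists 0, 1; rewrite rmorph0 rmorph1 !hornerC mul1r add0r.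
have St : order2 theta /\ multiple_of order2 2 (theta ^+ 4 - theta).
  split => //; exists (theta * (delta - 1)); last first.
    by rewrite exprS theta3_delta; ring.
  by apply: (subr_M OP) => //; apply: (subr_B OP) => //; exact: subr_1.
have Sd : order2 delta /\ multiple_of order2 2 (delta ^+ 4 - delta).
  split => //; have [k Ek] : exists k, c ^+ 2 + c = 2 * k.
    by exists ((c ^+ 2 + c) %/ 2)%Z; have := divz_eq c 2; nia.
  exists (c%:~R * delta + k%:~R).
    by apply: (subr_D OP); [apply: (subr_M OP) => //|]; exact: subr_int.
  have Ek' : c%:~R ^+ 2 = 2%:R * k%:~R - c%:~R :> K.
    by apply/eqP; rewrite -subr_eq opprK -rmorphXn -rmorphD Ek rmorphM.
  by have := delta_sq; move: delta => d Ed; ring : Ed Ek'.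
by apply: (subr_D SP); [|apply: (subr_M SP) => //]; apply: (subr_zev SP).
Qed.

(** Integrality puts a power of 2 z in 2 O, and 2 O is a radical ideal of O by
    [frobenius_fixed_radical]. *)
Lemma order2_saturated : saturated_at order2 2.
Proof.
move=> z iz Oz.
have [d [y Oy E]] := integer_multiple_power order2_subring iz Oz.
have : multiple_of order2 2 (2%:~R * z); last by case=> y' Oy' /(mulfI two_neq0) ->.
apply: (frobenius_fixed_radical order2_subring _ _ (q := 4) (d := d)) => //.
- exact: (multipleD order2_subring).
- exact: (multipleM order2_subring).
- exact: order2_frobenius.
- exact: (multiple0 _ order2_subring).
- by exists y.
Qed.

(** Saturation at 2 puts some odd multiple b = (2 j + 1) x in the order; b = x modulo 2 Z_K, so the
    congruence passes from b to x. *)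
Lemma integer_frobenius2 (x : K) : ring_of_integers x ->
  exists2 y, ring_of_integers y & x ^+ 4 - x = 2%:R * y.
Proof.
move=> ix; have IP := integer_subring K.
have [N N0 xN] := multiple_in_Zadjoin hK x.
have [j [k EN]] : exists j k, N = 2 ^+ k * (2 * j + 1).
  exact: int_odd_part.
pose b := (2 * j + 1)%:~R * x.
have ib : ring_of_integers b by apply: (subr_M IP) => //; exact: subr_int.
have Ob : order2 b.
  apply: (saturated_pow (k := k) order2_saturated ib).
  by rewrite /b mulrA -rmorphM -EN; exact: order2_Zadjoin.
have [y Oy Ey] := order2_frobenius Ob.
have iy := order2_integer Oy.
pose w : K := j%:~R * x.
(* Half of (b - 2 w)^4 - (b - 2 w), where b^4 - b = 2 y. *)
exists (y + w - 4%:R * (b ^+ 3 * w) + 12%:R * (b ^+ 2 * w ^+ 2)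
  - 16%:R * (b * w ^+ 3) + 8%:R * w ^+ 4).
  have iw : ring_of_integers w by apply: (subr_M IP) => //; exact: subr_int.
  by subr_tac IP.
have Ex : x = b - 2%:R * w by rewrite /b /w rmorphD rmorphM /=; ring.
have Ey' : b ^+ 4 = 2%:R * y + b by rewrite -[b ^+ 4](subrK b) Ey.
by rewrite {}Ex; move: b w Ey' {Ey iy Oy ib Ob} => b w Ey; ring : Ey.
Qed.

Lemma not_monogenic_1_mod_4 : ~ monogenic K.
Proof.
move=> [x [ix xP]].
have [_ /xP[P ->] E] := integer_frobenius2 ix.
have [g [mg _ sg gd]] := integral_minpoly ix.
have g7 : (7 <= size g)%N.
  by rewrite sg ltnS; apply: generator_degree; apply/xP; exact: theta_integer htheta.
(* Modulo 2 this polynomial is X^4 - X, which would be a nonzero multiple of a monic polynomial of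
   degree at least 6. *)
have [|Q EQ] := gd ('X^4 - 'X - 2%:P * P); first by rewrite !zevE E subrr.
have : map_poly (intr : int -> 'F_2) ('X^4 - 'X - 2%:P * P) = 'X^4 - 'X.
  rewrite !rmorphB /= map_polyXn map_polyX (rmorphM _ 2%:P) /= map_polyC /=.
  have -> : (2%:~R : 'F_2) = 0 by apply/eqP; rewrite Fp_intr_eq0.
  by rewrite mul0r subr0.
rewrite EQ rmorphM /= => E2.
have s5 : size ('X^4 - 'X : {poly 'F_2}) = 5%N.
  by rewrite size_polyDl ?size_polyXn // size_polyN size_polyX.
have Q0 : map_poly (intr : int -> 'F_2) Q != 0.
  by apply/eqP => Q0; move: s5; rewrite -E2 Q0 mul0r size_poly0.
move: s5; rewrite -E2 size_Mmonic ?monic_map //.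
have -> : size (map_poly (intr : int -> 'F_2) g) = size g.
  by rewrite size_map_poly_id0 // (monicP mg) rmorph1 oner_eq0.
rewrite -size_poly_gt0 in Q0; move: Q0 g7; lia.
Qed.
End OneModFour.

(** * The case m = +-1 (mod 9) *)

Section OrderAtThree.
Variables (m eps n : int) (K : fieldExtType rat) (theta : K).
Hypotheses (hsf : squarefreez m) (hm0 : m <> 0) (hm1 : m <> 1) (hmN1 : m <> -1).
Hypotheses (htheta : theta ^+ 6 = m%:~R) (hK : <<1%VS; theta>>%VS = {:K}%VS).
Hypotheses (hm : m = eps + 9 * n) (heps : eps ^+ 2 = 1).

Let e : K := eps%:~R.
Let k : K := n%:~R.
Let tau : K := theta ^+ 2 - e.
Definition rho3 : K := (theta ^+ 2 - eps%:~R) ^+ 2 / 3%:R.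
Let rho := rho3.

Lemma three_neq0 : (3%:R : K) != 0.
Proof. by rewrite (intK_eq0 K 3). Qed.

Lemma eps_sq : e ^+ 2 = 1.
Proof. by rewrite /e -rmorphXn heps. Qed.

Lemma theta6 : theta ^+ 6 = e + 9%:R * k.
Proof. by rewrite htheta hm rmorphD rmorphM. Qed.

Lemma tau_sq : tau ^+ 2 = 3%:R * rho.
Proof. by rewrite /rho /rho3 mulrC divfK ?three_neq0. Qed.

(** Expand (tau + e)^3 = theta^6 = e + 9 k with e^2 = 1 and tau^2 = 3 rho, then divide by 3. *)
Lemma tau_rho : tau * rho = 3%:R * k - tau - 3%:R * e * rho.
Proof.
apply: (mulfI three_neq0); rewrite mulrCA -tau_sq !mulrBr.
have -> : 3%:R * (3%:R * e * rho) = 3%:R * e * tau ^+ 2 by rewrite tau_sq; ring.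
by have [E1 E2] := conj theta6 eps_sq; rewrite /tau; move: e k E1 E2 => e' k' E1 E2;
  ring : E1 E2.
Qed.

Lemma rho_sq : rho ^+ 2 = (k + e) * tau - 3%:R * e * k + 2%:R * rho.
Proof.
apply: (mulfI three_neq0).
have -> : 3%:R * rho ^+ 2 = tau * (tau * rho) by rewrite mulrA -expr2 tau_sq; ring.
rewrite tau_rho; have [E1 [E2 E3]] := conj tau_rho (conj tau_sq eps_sq).
by move: e k tau rho E1 E2 E3 => e' k' t r E1 E2 E3; ring : E1 E2 E3.
Qed.

Definition order3 (x : K) : Prop := exists P Q, x = zev P theta + zev Q theta * rho3.

Let tauP : {poly int} := 'X^2 - eps%:P.
Lemma zev_tauP : zev tauP theta = tau.
Proof. by rewrite /tauP !zevE. Qed.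

Lemma order3_subring : is_subring order3.
Proof.
split.
- by exists 1, 0; rewrite rmorph1 rmorph0 !hornerC mul0r addr0.
- by move=> _ _ [P [Q ->]] [P' [Q' ->]]; exists (P - P'), (Q - Q'); rewrite !zevE; ring.
move=> _ _ [P [Q ->]] [P' [Q' ->]].
exists (P * P' + Q * Q' * ((n + eps)%:P * tauP - (3 * eps * n)%:P)),
  (P * Q' + Q * P' + Q * Q' * 2%:P).
rewrite zevD (zevD (_ + _)) !zevM !zevB !zevM zevD !zevM !zevC zev_tauP.
rewrite !rmorphM /= rmorphD /= -/e -/k.
have := rho_sq; rewrite -/rho; move: rho tau (zev P _) (zev Q _) (zev P' _) (zev Q' _)
  => d t p q p' q' E.
by ring : E.
Qed.

Lemma order3_Zadjoin x : in_Zadjoin theta x -> order3 x.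
Proof. by move=> [P ->]; exists P, 0; rewrite rmorph0 hornerC mul0r addr0. Qed.

Lemma order3_theta : order3 theta.
Proof. by apply: order3_Zadjoin; exact: Zadjoin_self. Qed.

Lemma order3_rho : order3 rho.
Proof. by exists 0, 1; rewrite rmorph0 rmorph1 !hornerC mul1r add0r. Qed.

Lemma order3_tau : order3 tau.
Proof. by apply: order3_Zadjoin; exists tauP; rewrite zev_tauP. Qed.

(** The cubic arises on multiplying [rho_sq] by [rho] and eliminating [tau] through [tau_rho] and
    [rho_sq]. *)
Lemma rho_integer : ring_of_integers rho.
Proof.
pose g : {poly int} := 'X^3 + ((-1) *: 'X^2 + ((3 * eps * n - 2 + 3 * eps * (n + eps)) *: 'X
  + (3 * eps * n - 3 * n * (n + eps))%:P)).
exists g.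
  rewrite /g monicE lead_coefDl ?lead_coefXn // size_polyXn ltnS.
  rewrite (leq_trans (size_polyD _ _)) // geq_max (leq_trans (size_scale_leq _ _))
    ?size_polyXn //=.
  rewrite (leq_trans (size_polyD _ _)) // geq_max (leq_trans (size_scale_leq _ _)) ?size_polyX
    //=.
  by rewrite (leq_trans (size_polyC_leq1 _)).
apply/rootP; rewrite /g -!mul_polyC !(zevD, zevM, zevXn, zevC, zevX).
rewrite !(rmorphD, rmorphB, rmorphM, rmorphN, rmorph1) /= -/e -/k.
have [E1 [E2 E3]] := conj tau_rho (conj rho_sq eps_sq).
by move: e k tau rho E1 E2 E3 => e' k' t r E1 E2 E3; ring : E1 E2 E3.
Qed.

Lemma order3_integer x : order3 x -> ring_of_integers x.
Proof.
have zi P : ring_of_integers (zev P theta).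
  by apply: subr_zev; [exact: integer_subring | exact: theta_integer htheta].
move=> [P [Q ->]]; apply: (subr_D (integer_subring K)) => //.
by apply: (subr_M (integer_subring K)) => //; exact: rho_integer.
Qed.

(** Because tau^2 = 3 rho, the ideal 3 O is not radical; the ideal (3, tau) takes its place. *)
Definition ideal3 (x : K) : Prop :=
  exists a b, [/\ order3 a, order3 b & x = 3%:R * a + tau * b].

Lemma ideal3D x y : ideal3 x -> ideal3 y -> ideal3 (x + y).
Proof.
have OP := order3_subring.
move=> [a [b [Oa Ob ->]]] [a' [b' [Oa' Ob' ->]]]; exists (a + a'), (b + b').
by split; [subr_tac OP | subr_tac OP | ring].
Qed.

Lemma ideal3M x y : order3 x -> ideal3 y -> ideal3 (x * y).
Proof.
have OP := order3_subring.
move=> Ox [a [b [Oa Ob ->]]]; exists (x * a), (x * b).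
by split; [subr_tac OP | subr_tac OP | ring].
Qed.

Lemma ideal3_0 : ideal3 0.
Proof. by exists 0, 0; split; [exact: (subr_0 order3_subring) ..| ring]. Qed.

(** On generators: theta^8 - 1 is a multiple of theta^4 - 1 = tau (theta^2 + e), and rho^2 = 2 rho
    modulo (3, tau), whence rho^9 = 2^8 rho = rho. The exponent is 9 rather than 3 because theta^2 =
    -1 modulo [tau] when [eps] = -1. *)
Lemma order3_frobenius x : order3 x -> ideal3 (x ^+ 9 - x).
Proof.
have OP := order3_subring.
have [Ot [Or Otau]] := conj order3_theta (conj order3_rho order3_tau).
have Oe : order3 e by exact: subr_int.
have Ok : order3 k by exact: subr_int.
have SP : is_subring (fun x => order3 x /\ ideal3 (x ^+ 9 - x)).
  apply: (frobenius_fixed_subring OP ideal3D ideal3M) ideal3_0 => {}x y Ox Oy.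
  exists (- 3%:R * (x ^+ 8 * y) + 12%:R * (x ^+ 7 * y ^+ 2) - 28%:R * (x ^+ 6 * y ^+ 3)
    + 42%:R * (x ^+ 5 * y ^+ 4) - 42%:R * (x ^+ 4 * y ^+ 5) + 28%:R * (x ^+ 3 * y ^+ 6)
    - 12%:R * (x ^+ 2 * y ^+ 7) + 3%:R * (x * y ^+ 8)), 0.
  by split; [subr_tac OP | exact: subr_0 | ring].
have St : order3 theta /\ ideal3 (theta ^+ 9 - theta).
  split => //; exists 0, (theta * ((theta ^+ 2 + e) * (theta ^+ 4 + 1))).
  split; [exact: subr_0 | by subr_tac OP |].
  by have := eps_sq; rewrite /tau; move: e => e' E; ring : E.
have Sr : order3 rho /\ ideal3 (rho ^+ 9 - rho).
  split => //.
  (* This is (rho^8 - 2^8) / (rho - 2); the 85 below is 255 / 3. *)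
  pose q := rho ^+ 7 + 2%:R * rho ^+ 6 + 4%:R * rho ^+ 5 + 8%:R * rho ^+ 4
    + 16%:R * rho ^+ 3 + 32%:R * rho ^+ 2 + 64%:R * rho + 128%:R.
  have Oq : order3 q by rewrite /q; subr_tac OP.
  exists (85%:R * rho - e * (k * q)), ((k + e) * q).
  split; [by subr_tac OP | by subr_tac OP |].
  have -> : rho ^+ 9 - rho = (rho ^+ 2 - 2%:R * rho) * q + 255%:R * rho by rewrite /q; ring.
  by rewrite rho_sq; move: q Oq => q _; ring.
move=> [P [Q ->]].
have [//] : order3 (zev P theta + zev Q theta * rho3) /\
  ideal3 ((zev P theta + zev Q theta * rho3) ^+ 9 - (zev P theta + zev Q theta * rho3)).
by apply: (subr_D SP); [|apply: (subr_M SP) => //]; apply: (subr_zev SP).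
Qed.

Lemma order3_radical x d : order3 x -> ideal3 (x ^+ d) -> ideal3 x.
Proof.
move=> Ox; apply: (frobenius_fixed_radical order3_subring ideal3D ideal3M (q := 9)) => //.
- exact: order3_frobenius.
- exact: ideal3_0.
Qed.

(** A power of 3 z lies in 3 O, hence in the radical ideal (3, tau). *)
Lemma integer_triple_ideal3 z : ring_of_integers z -> order3 (3%:R * z) -> ideal3 (3%:R * z).
Proof.
move=> iz Oz; have [d [y Oy E]] := integer_multiple_power order3_subring (p := 3) iz Oz.
apply: (@order3_radical _ d) => //; rewrite E; exists y, 0.
by split=> //; [exact: (subr_0 order3_subring) | rewrite mulr0 addr0].
Qed.

(* If 3 w = tau b, squaring gives 3 w^2 = rho b^2, so rho b lies in [ideal3];
   then tau rho b lies in 3 O because tau^2 = 3 rho, and tau rho = - tau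
   modulo 3 O. *)
Lemma order3_saturated : saturated_at order3 3.
Proof.
move=> z iz Oz; have OP := order3_subring; have IP := integer_subring K.
have [Or Otau] := conj order3_rho order3_tau.
have Oe : order3 e by exact: subr_int.
have Ok : order3 k by exact: subr_int.
have [a [b [Oa Ob E]]] := integer_triple_ideal3 iz Oz.
pose w := z - a.
have iw : ring_of_integers w by apply: (subr_B IP) => //; exact: order3_integer.
have Ew : 3%:R * w = tau * b by rewrite /w mulrBr E; ring.
have Ew2 : 3%:R * (rho * w ^+ 2) = (rho * b) ^+ 2.
  apply: (mulfI three_neq0).
  have -> : 3%:R * (3%:R * (rho * w ^+ 2)) = rho * (3%:R * w) ^+ 2 by ring.
  by rewrite Ew exprMn tau_sq; ring.
have [||a' [b' [Oa' Ob' E']]] := @order3_radical (rho * b) 2.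
- by subr_tac OP.
- rewrite -Ew2; apply: integer_triple_ideal3; last by rewrite Ew2; subr_tac OP.
  by have ir := rho_integer; subr_tac IP.
have Eb : tau * b = 3%:R * (k * b - e * (rho * b) - tau * a' - rho * b').
  have H : tau * rho * b = 3%:R * (tau * a') + tau ^+ 2 * b'.
    by rewrite -mulrA E'; ring.
  move: H; rewrite tau_rho tau_sq => /(congr1 (fun x => 3%:R * k * b - 3%:R * e * rho * b - x)).
  by rewrite !(mulrBr, mulrBl) => H; apply: etrans (etrans H _); ring.
have -> : z = w + a by rewrite /w subrK.
apply: (subr_D OP) => //.
have -> : w = k * b - e * (rho * b) - tau * a' - rho * b'.
  by apply: (mulfI three_neq0); rewrite Ew Eb.
by subr_tac OP.
Qed.

Lemma integer_order3 x : ~~ (4 %| m * (m - 1))%Z -> ring_of_integers x -> order3 x.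
Proof.
move=> m4 ix; have [N N0 xN] := multiple_in_Zadjoin hK x.
have [|j xj] := integers_in_order (q := 3) _ N0 ix xN (Zadjoin_subring theta).
  by move=> p; exact: saturated_away_from_3 hsf hm0 hm1 hmN1 htheta p m4.
apply: saturated_pow order3_saturated ix _; exact: order3_Zadjoin xj.
Qed.
End OrderAtThree.

(** * Algebraic integers and the embeddings of K into the algebraic numbers *)

Lemma Aint_zev (P : {poly int}) (a : algC) : a \in Aint -> zev P a \in Aint.
Proof.
move=> ia; rewrite horner_coef; apply: rpred_sum => i _.
by rewrite coef_map /= rpredM ?rpredX ?Aint_int.
Qed.

(** For a, b two conjugates of a generator, this is the divisibility from which the index forms are
    built. *)
Lemma Aint_zev_sub (P : {poly int}) (a b : algC) : a \in Aint -> b \in Aint ->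
  exists2 Q, Q \in Aint & zev P a - zev P b = (a - b) * Q.
Proof.
move=> ia ib; elim/poly_ind: P => [|P c [Q iQ E]].
  by exists 0; [exact: rpred0 | rewrite rmorph0 !hornerC subrr mulr0].
exists (Q * a + zev P b); first by rewrite rpredD ?rpredM ?Aint_zev.
by rewrite !zevE mulrDr mulrA -E; ring.
Qed.

(** For nonzero a, Q is a rational algebraic integer, hence an integer. *)
Lemma dvdz_Aint (a b : int) (Q : algC) : Q \in Aint -> b%:~R = a%:~R * Q -> (a %| b)%Z.
Proof.
move=> iQ E; have [a0|a0] := eqVneq a 0.
  move: E; rewrite a0 mul0r => /eqP; rewrite intr_eq0 => /eqP ->; exact: dvdz0.
have EQ : Q = b%:~R / a%:~R by rewrite E mulrAC divff ?mul1r // intr_eq0.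
have /intrP[q Eq] : Q \in Num.int.
  by apply: Cint_rat_Aint => //; rewrite EQ rpred_div ?rpred_int.
apply/dvdzP; exists q; apply: (@intr_inj algC).
by rewrite rmorphM /= -Eq mulrC.
Qed.

Section Embeddings.
Variables (m : int) (K : fieldExtType rat) (theta : K).
Hypotheses (hsf : squarefreez m) (hm0 : m <> 0) (hm1 : m <> 1) (hmN1 : m <> -1).
Hypotheses (htheta : theta ^+ 6 = m%:~R) (hK : <<1%VS; theta>>%VS = {:K}%VS).

Lemma rat_poly_transfer (q : {poly rat}) (s : algC) : s ^+ 6 = m%:~R ->
  (map_poly (in_alg K) q).[theta] = 0 -> (map_poly ratr q).[s] = 0.
Proof.
move=> hs; have [P [a a0 ->]] := rat_poly_scale q.
have E1 : map_poly (in_alg K) (map_poly intr P) = map_poly intr P.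
  by rewrite -map_poly_comp; apply: eq_map_poly => n /=; rewrite -(rmorph_int (in_alg K)).
have E2 : map_poly (ratr : rat -> algC) (map_poly intr P) = map_poly intr P.
  by rewrite -map_poly_comp; apply: eq_map_poly => n /=; rewrite rmorph_int.
rewrite !map_polyZ !hornerZ E1 E2 => /eqP;
  rewrite mulf_eq0 fmorph_eq0 invr_eq0 intr_eq0 (negPf a0) /=.
move=> /eqP /(zev_sixth_transfer hsf hm0 hm1 hmN1 (in_alg K) htheta hs) ->.
by rewrite mulr0.
Qed.

(** The map sends q(theta) to q(s) for a chosen rational q; [rat_poly_transfer] makes the value
    independent of the choice. *)
Lemma embedding_exists (s : algC) : s ^+ 6 = m%:~R ->
  exists phi : {rmorphism K -> algC}, phi theta = s.
Proof.
move=> hs.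
have rep x : exists q, x == (map_poly (in_alg K) q).[theta].
  by have /Fadjoin1_polyP[q ->] : x \in <<1; theta>>%VS; [rewrite hK memvf | exists q].
pose phi x := (map_poly ratr (xchoose (rep x))).[s] : algC.
have phiE q : phi (map_poly (in_alg K) q).[theta] = (map_poly ratr q).[s].
  apply/eqP; rewrite -subr_eq0 -hornerN -hornerD -rmorphB /=; apply/eqP.
  apply: rat_poly_transfer => //; rewrite rmorphB hornerD hornerN /=.
  by rewrite -(eqP (xchooseP (rep _))) subrr.
have phiB : {morph phi : x y / x - y}.
  move=> x y; have [[p /eqP ->] [q /eqP ->]] := conj (rep x) (rep y).
  by rewrite -hornerN -hornerD -rmorphB !phiE rmorphB hornerD hornerN.
have phi1 : phi 1 = 1.
  by have := phiE 1; rewrite !rmorph1 !hornerC.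
have phiM : {morph phi : x y / x * y}.
  move=> x y; have [[p /eqP ->] [q /eqP ->]] := conj (rep x) (rep y).
  by rewrite -hornerM -rmorphM !phiE rmorphM hornerM.
pose mB := GRing.isZmodMorphism.Build K algC phi phiB.
pose mM := GRing.isMonoidMorphism.Build K algC phi (phi1, phiM).
pose phi' : {rmorphism K -> algC} := HB.pack phi mB mM.
exists phi'; rewrite /phi' /=.
by have := phiE 'X; rewrite !map_polyX !hornerX.
Qed.

Lemma embedding_Aint (phi : {rmorphism K -> algC}) x :
  ring_of_integers x -> phi x \in Aint.
Proof.
move=> [g mg /rootP gx]; apply: (@root_monic_Aint (map_poly intr g)).
- by apply/rootP; rewrite -zev_rmorph gx rmorph0.
- by rewrite monic_map.
- by apply/polyOverP => i; rewrite coef_map /= rpred_int.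
Qed.

(** The coordinates are split by the parity of the power of s, since the conjugates at s and - s
    differ only in the odd part A, B, C. *)
Definition sextic_elt (R : nzRingType) (s : R) (X Y Z A B C : int) : R :=
  X%:~R + Y%:~R * s ^+ 2 + Z%:~R * s ^+ 4 + s * (A%:~R + B%:~R * s ^+ 2 + C%:~R * s ^+ 4).

(** The coordinates are those of 3 alpha and 3 z, to clear the denominator of [rho3]; the factor 3
    appears on both sides. *)
Lemma sextic_elt_sub_dvd (alpha z : K) X Y Z A B C X' Y' Z' A' B' C' (r1 r2 : algC) :
  ring_of_integers alpha -> in_Zadjoin alpha z ->
  3%:R * alpha = sextic_elt theta X Y Z A B C ->
  3%:R * z = sextic_elt theta X' Y' Z' A' B' C' ->
  r1 ^+ 6 = m%:~R -> r2 ^+ 6 = m%:~R ->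
  exists2 Q, Q \in Aint &
    sextic_elt r1 X' Y' Z' A' B' C' - sextic_elt r2 X' Y' Z' A' B' C'
    = (sextic_elt r1 X Y Z A B C - sextic_elt r2 X Y Z A B C) * Q.
Proof.
move=> ia [P ->] Ea Ez h1 h2.
have [phi1 e1] := embedding_exists h1; have [phi2 e2] := embedding_exists h2.
have [Q iQ E] := Aint_zev_sub P (embedding_Aint phi1 ia) (embedding_Aint phi2 ia).
have im (phi : {rmorphism K -> algC}) x X0 Y0 Z0 A0 B0 C0 : 3%:R
  * x = sextic_elt theta X0 Y0 Z0 A0 B0 C0 ->
   sextic_elt (phi theta) X0 Y0 Z0 A0 B0 C0 = 3%:R * phi x.
  move=> /(congr1 phi); rewrite rmorphM rmorph_nat => ->; rewrite /sextic_elt.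
  by rewrite !(rmorphD, rmorphM, rmorphXn, rmorph_int).
exists Q => //; rewrite -e1 -e2 !(im _ _ _ _ _ _ _ _ Ea) !(im _ _ _ _ _ _ _ _ Ez).
by rewrite !zev_rmorph -!mulrBr E mulrA.
Qed.
End Embeddings.

(* The norm of A + B t + C t^2, where t^3 = m. *)
Definition cubic_norm (m A B C : int) : int :=
  A ^+ 3 + m * B ^+ 3 + m ^+ 2 * C ^+ 3 - 3 * m * A * B * C.

(** A root of the sixth cyclotomic polynomial, that is, a primitive sixth root of unity. *)
Lemma sixth_unity_exists : exists z : algC, z ^+ 2 = z - 1.
Proof.
exists ((1 + sqrtC (- 3%:R)) / 2%:R).
by have := sqrtCK (- 3%:R : algC); move: (sqrtC _) => x E; field : E.
Qed.

(** * Products of differences of conjugates *)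

Section Conjugates.
Variables (m : int) (hm0 : m <> 0) (zeta : algC) (hz : zeta ^+ 2 = zeta - 1).

Lemma zeta_root (r : algC) : r ^+ 6 = m%:~R -> (zeta * r) ^+ 6 = m%:~R.
Proof. by move=> hr; ring : hz hr. Qed.

Lemma sixth_root_neq0 (r : algC) : r ^+ 6 = m%:~R -> r != 0.
Proof.
move=> hr; apply/eqP => r0; apply: hm0; apply: (@intr_inj algC).
by rewrite -hr r0 expr0n.
Qed.

(** The squares of r, zeta r, zeta^2 r are the three cube roots of m, so multiplying the three
    equations gives norms. *)
Lemma cubic_norm_dvd (a b c a' b' c' : int) :
  (forall r : algC, r ^+ 6 = m%:~R -> exists2 Q, Q \in Aint &
     a'%:~R + b'%:~R * r ^+ 2 + c'%:~R * r ^+ 4 =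
     (a%:~R + b%:~R * r ^+ 2 + c%:~R * r ^+ 4) * Q) ->
  (cubic_norm m a b c %| cubic_norm m a' b' c')%Z.
Proof.
move=> H; pose r : algC := 6.-root m%:~R.
have hr : r ^+ 6 = m%:~R by exact: rootCK.
have [Q0 i0 E0] := H _ hr.
have [Q1 i1 E1] := H _ (zeta_root hr).
have [Q2 i2 E2] := H _ (zeta_root (zeta_root hr)).
apply: (@dvdz_Aint _ _ (Q0 * Q1 * Q2)); first by rewrite !rpredM.
have nE x y z : (cubic_norm m x y z)%:~R =
   (x%:~R + y%:~R * r ^+ 2 + z%:~R * r ^+ 4)
   * (x%:~R + y%:~R * (zeta * r) ^+ 2 + z%:~R * (zeta * r) ^+ 4)
   * (x%:~R + y%:~R * (zeta * (zeta * r)) ^+ 2 + z%:~R * (zeta * (zeta * r)) ^+ 4).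
  rewrite /cubic_norm !(rmorphB, rmorphD, rmorphM, rmorphXn) /=.
  by ring : hz hr.
by rewrite !nE E0 E1 E2; ring.
Qed.

Variables (r : algC) (hr : r ^+ 6 = m%:~R).
Variables (X Y Z A B C : int).
Local Notation el s := (sextic_elt s X Y Z A B C).

Lemma opposite_conjugates : el r - el (zeta * (zeta * (zeta * r))) =
  2%:R * r * (A%:~R + B%:~R * r ^+ 2 + C%:~R * r ^+ 4).
Proof. by rewrite /sextic_elt; ring : hz. Qed.

(** Coefficients in powers of r^2 of the product in [skew_conjugates] divided by 3 r^2; the adjacent
    ones arise likewise from [adjacent_conjugates], divided by - r^2. *)
Definition skew_coef0 := A ^+ 2 - m * Z ^+ 2.
Definition skew_coef1 := m * C ^+ 2 - Y ^+ 2.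
Definition skew_coef2 := 2 * Y * Z - 2 * A * C.
Definition adjacent_coef0 := A ^+ 2 - 4 * B * C * m + 3 * m * Z ^+ 2.
Definition adjacent_coef1 := m * C ^+ 2 - 4 * A * B + 3 * Y ^+ 2.
Definition adjacent_coef2 := 4 * B ^+ 2 + 2 * A * C - 6 * Y * Z.

(** The second difference is the first one with r replaced by - r = zeta^3 r, so the product is even
    in r. The same pairing serves in [adjacent_conjugates]. *)
Lemma skew_conjugates :
  (el (zeta * r) - el (zeta * (zeta * (zeta * (zeta * (zeta * r)))))) *
  (el (zeta * (zeta * (zeta * (zeta * r)))) - el (zeta * (zeta * r))) =
  3%:R * r ^+ 2 * (skew_coef0%:~R + skew_coef1%:~R * r ^+ 2 + skew_coef2%:~R * r ^+ 4).
Proof.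
rewrite /sextic_elt /skew_coef0 /skew_coef1 /skew_coef2 !(rmorphB, rmorphD, rmorphM, rmorphXn)
  /=.
by ring : hz hr.
Qed.

Lemma adjacent_conjugates :
  (el (zeta * r) - el (zeta * (zeta * r))) *
  (el (zeta * (zeta * (zeta * (zeta * r)))) - el (zeta * (zeta * (zeta * (zeta * (zeta
    * r)))))) =
  - r ^+ 2 * (adjacent_coef0%:~R + adjacent_coef1%:~R * r ^+ 2 + adjacent_coef2%:~R * r ^+ 4).
Proof.
rewrite /sextic_elt /adjacent_coef0 /adjacent_coef1 /adjacent_coef2
  !(rmorphB, rmorphD, rmorphM, rmorphXn) /=.
by ring : hz hr.
Qed.
End Conjugates.

(** * Divisibility between the values of the three index forms *)

Section IndexForms.
Variables (m : int) (K : fieldExtType rat) (theta : K).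
Hypotheses (hsf : squarefreez m) (hm0 : m <> 0) (hm1 : m <> 1) (hmN1 : m <> -1).
Hypotheses (htheta : theta ^+ 6 = m%:~R) (hK : <<1%VS; theta>>%VS = {:K}%VS).
Variables (alpha z : K) (X Y Z A B C X' Y' Z' A' B' C' : int).
Hypotheses (ia : ring_of_integers alpha) (az : in_Zadjoin alpha z)
  (Ea : 3%:R * alpha = sextic_elt theta X Y Z A B C)
  (Ez : 3%:R * z = sextic_elt theta X' Y' Z' A' B' C').

Let sub_dvd r1 r2 := @sextic_elt_sub_dvd m K theta hsf hm0 hm1 hmN1 htheta hK
  alpha z X Y Z A B C X' Y' Z' A' B' C' r1 r2 ia az Ea Ez.

Lemma index_form1_dvd : (cubic_norm m A B C %| cubic_norm m A' B' C')%Z.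
Proof.
have [w hw] := sixth_unity_exists; have zr r := @zeta_root m _ hw r.
apply: (cubic_norm_dvd hw) => r hr.
have r0 := sixth_root_neq0 hm0 hr.
have [Q iQ E] := sub_dvd hr (zr _ (zr _ (zr _ hr))).
have c0 : 2%:R * r != 0 by rewrite mulf_neq0 // pnatr_eq0.
by exists Q => //; move: E; rewrite !(opposite_conjugates hw) -[X in _ = X]mulrA => /(mulfI c0).
Qed.

Lemma index_form2_dvd :
  (cubic_norm m (skew_coef0 m Z A) (skew_coef1 m Y C) (skew_coef2 Y Z A C) %|
   cubic_norm m (skew_coef0 m Z' A') (skew_coef1 m Y' C') (skew_coef2 Y' Z' A' C'))%Z.
Proof.
have [w hw] := sixth_unity_exists; have zr r := @zeta_root m _ hw r.
apply: (cubic_norm_dvd hw) => r hr.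
have r0 := sixth_root_neq0 hm0 hr.
have h1 := zr _ hr; have h2 := zr _ h1; have h4 := zr _ (zr _ h2); have h5 := zr _ h4.
have [Q iQ E] := sub_dvd h1 h5; have [Q' iQ' E'] := sub_dvd h4 h2.
exists (Q * Q'); first by rewrite rpredM.
have := skew_conjugates hw hr X' Y' Z' A' B' C'; rewrite E E' mulrACA.
have c0 : 3%:R * r ^+ 2 != 0 by rewrite mulf_neq0 ?expf_neq0 // pnatr_eq0.
by rewrite (skew_conjugates hw hr X Y Z A B C) -[X in X = _]mulrA => /(mulfI c0).
Qed.

Lemma index_form3_dvd :
  (cubic_norm m (adjacent_coef0 m Z A B C) (adjacent_coef1 m Y A B C) (adjacent_coef2 Y Z A B
    C) %|
   cubic_norm m (adjacent_coef0 m Z' A' B' C') (adjacent_coef1 m Y' A' B' C') (adjacent_coef2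
     Y' Z' A' B' C'))%Z.
Proof.
have [w hw] := sixth_unity_exists; have zr r := @zeta_root m _ hw r.
apply: (cubic_norm_dvd hw) => r hr.
have r0 := sixth_root_neq0 hm0 hr.
have h1 := zr _ hr; have h2 := zr _ h1; have h4 := zr _ (zr _ h2); have h5 := zr _ h4.
have [Q iQ E] := sub_dvd h1 h2; have [Q' iQ' E'] := sub_dvd h4 h5.
exists (Q * Q'); first by rewrite rpredM.
have := adjacent_conjugates hw hr X' Y' Z' A' B' C'; rewrite E E' mulrACA.
have c0 : - r ^+ 2 != 0 by rewrite oppr_eq0 expf_neq0.
by rewrite (adjacent_conjugates hw hr X Y Z A B C) -[X in X = _]mulrA => /(mulfI c0).
Qed.
End IndexForms.

(** * Integral coordinates on the order at 3 *)

Section Coordinates.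
Variables (m eps n : int) (K : fieldExtType rat) (theta : K).
Hypotheses (htheta : theta ^+ 6 = m%:~R) (hm : m = eps + 9 * n) (heps : eps ^+ 2 = 1).

(* Coordinates p, q, w of p + q t + w rho, multiplied by 3. *)
Definition order3_coord (x : K) : Prop := exists p q w p' q' w' : int,
  3%:R * x = sextic_elt theta (3 * p + w) (3 * q - 2 * eps * w) w
                              (3 * p' + w') (3 * q' - 2 * eps * w') w'.

Lemma order3_coordD x y : order3_coord x -> order3_coord y -> order3_coord (x + y).
Proof.
move=> [p [q [w [p' [q' [w' E]]]]]] [a [b [c [a' [b' [c' E']]]]]].
exists (p + a), (q + b), (w + c), (p' + a'), (q' + b'), (w' + c').
rewrite mulrDr E E' /sextic_elt !(rmorphD, rmorphB, rmorphM) /=; ring.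
Qed.

Lemma order3_coord_theta x : order3_coord x -> order3_coord (x * theta).
Proof.
move=> [p [q [w [p' [q' [w' E]]]]]].
(* With t = theta^2, the new even part is (p' + q' t + w' rho) t, reduced by t^2 = 3 rho + 2 eps t -
   1 and t rho = 3 n + eps - t - 2 eps rho. *)
exists (eps * w' + 3 * n * w' - q'), (p' - w' + 2 * eps * q'), (3 * q' - 2 * eps * w'), p, q, w.
rewrite mulrA E /sextic_elt !(rmorphD, rmorphB, rmorphM) /=.
have E6 : theta ^+ 6 = eps%:~R + 9%:R * n%:~R by rewrite htheta hm rmorphD rmorphM.
have Ee : eps%:~R ^+ 2 = 1 :> K by rewrite -rmorphXn heps.
by ring : E6 Ee.
Qed.

Lemma order3_coord_horner x P : order3_coord x ->
  (forall c : int, order3_coord (c%:~R * x)) -> order3_coord (zev P theta * x).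
Proof.
move=> Dx Dc; elim/poly_ind: P => [|P c IH]; first by rewrite rmorph0 hornerC; exact: (Dc 0).
rewrite !zevE mulrDl mulrAC; apply: order3_coordD; last exact: Dc.
exact: order3_coord_theta.
Qed.

Lemma order3_coordP x : order3 eps theta x -> order3_coord x.
Proof.
have Dc1 (c : int) : order3_coord (c%:~R * 1).
  by exists c, 0, 0, 0, 0, 0; rewrite /sextic_elt !(rmorphD, rmorphB, rmorphM) /=; ring.
have Dcr (c : int) : order3_coord (c%:~R * rho3 eps theta).
  exists 0, 0, c, 0, 0, 0.
  have E3 : 3%:R * rho3 eps theta = (theta ^+ 2 - eps%:~R) ^+ 2.
    by rewrite /rho3 mulrC divfK ?three_neq0.
  rewrite mulrCA E3 /sextic_elt !(rmorphD, rmorphB, rmorphM) /=.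
  have Ee : eps%:~R ^+ 2 = 1 :> K by rewrite -rmorphXn heps.
  by ring : Ee.
move=> [P [Q ->]]; rewrite -[zev P _]mulr1; apply: order3_coordD.
  by apply: order3_coord_horner => //; have := Dc1 1; rewrite mul1r.
by apply: order3_coord_horner => //; have := Dcr 1; rewrite mul1r.
Qed.
End Coordinates.

(** * Powers of 3 in the index forms *)

Section IndexFormArithmetic.
Variables (m eps n : int).
Hypotheses (hm : m = eps + 9 * n) (heps : eps ^+ 2 = 1).

Lemma eps_cases : eps = 1 \/ eps = -1.
Proof.
by move/eqP: heps; rewrite sqrf_eq1 => /orP[] /eqP; [left | right].
Qed.

(** The left side is the norm of 3 (p + q t + w rho), whence the factor 27. *)
Lemma cubic_norm_order (p q w : int) :
  cubic_norm m (3 * p + w) (3 * q - 2 * eps * w) w =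
  27 * (p ^+ 3 + p ^+ 2 * w + m * q ^+ 3 - 2 * eps * m * q ^+ 2 * w - m * p * q * w
        + (1 + 6 * eps * n) * p * w ^+ 2 + m * q * w ^+ 2 + 3 * n ^+ 2 * w ^+ 3).
Proof. by rewrite /cubic_norm hm; case: eps_cases => ->; ring. Qed.

(* In the basis 1, t, rho the second form has coordinates P, Q, W with
   P + eps Q = 3 R, which gives one more factor 3 than for a general integer. *)
Definition skew_norm (R Q W : int) : int :=
  9 * R ^+ 3 - 9 * eps * R ^+ 2 * Q + 3 * R * Q ^+ 2 + 3 * n * Q ^+ 3
  + (3 * R ^+ 2 - 2 * eps * R * Q) * W - 3 * eps * n * Q ^+ 2 * W - m * R * Q * W
  + (1 + 6 * eps * n) * R * W ^+ 2 + n * Q * W ^+ 2 + n ^+ 2 * W ^+ 3.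

Lemma cubic_norm_skew (R Q W : int) :
  cubic_norm m (3 * (3 * R - eps * Q) + W) (3 * Q - 2 * eps * W) W = 81 * skew_norm R Q W.
Proof.
by rewrite cubic_norm_order /skew_norm hm; case: eps_cases => ->; ring.
Qed.

Lemma index_form2_order (q w p' w' : int) :
  let A := 3 * p' + w' in let Y := 3 * q - 2 * eps * w in
  cubic_norm m (skew_coef0 m w A) (skew_coef1 m Y w') (skew_coef2 Y w A w') =
  81 * skew_norm (p' ^+ 2 + eps * n * w' ^+ 2 - (eps + n) * w ^+ 2 + 2 * q * w - eps * q ^+ 2)
    ((3 * n - eps) * w' ^+ 2 - 3 * q ^+ 2 + 8 * eps * q * w - 4 * w ^+ 2 - 4 * eps * p' * w')
    (6 * q * w - 4 * eps * w ^+ 2 - 6 * p' * w' - 2 * w' ^+ 2).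
Proof.
move=> A Y; rewrite -cubic_norm_skew; congr (cubic_norm _ _ _ _);
  rewrite /skew_coef0 /skew_coef1 /skew_coef2 /A /Y ?hm; case: eps_cases => ->; ring.
Qed.

(** The coefficients are 3 times those of [cubic_norm_order] at P, Q, W, so 27 comes out twice. *)
Lemma index_form3_order (q w p' q' w' : int) :
  let A := 3 * p' + w' in let B := 3 * q' - 2 * eps * w' in let Y := 3 * q - 2 * eps * w in
  exists F, cubic_norm m (adjacent_coef0 m w A B w') (adjacent_coef1 m Y A B w')
    (adjacent_coef2 Y w A B w') = 729 * F.
Proof.
move=> A B Y.
pose W := 12 * q' ^+ 2 - 16 * eps * q' * w' + 6 * w' ^+ 2 + 2 * p' * w' - 6 * q * w + 4 * eps
  * w ^+ 2.
pose P := p' ^+ 2 + (8 * eps * n - 1) * w' ^+ 2 + (4 * eps - 12 * n) * q' * w'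
  + (3 * n - eps) * w ^+ 2 - 4 * q' ^+ 2 + 2 * q * w.
pose Q := (5 * eps + n) * w' ^+ 2 - 4 * p' * q' + 4 * eps * p' * w' - 12 * q' * w' + 3 * q ^+ 2
  - 8 * eps * q * w + 4 * w ^+ 2 + 8 * eps * q' ^+ 2.
have cN a b c : cubic_norm m (3 * a) (3 * b) (3 * c) = 27 * cubic_norm m a b c.
  by rewrite /cubic_norm; ring.
have -> : adjacent_coef0 m w A B w' = 3 * (3 * P + W).
  by rewrite /adjacent_coef0 /A /B /P /W ?hm; case: eps_cases => ->; ring.
have -> : adjacent_coef1 m Y A B w' = 3 * (3 * Q - 2 * eps * W).
  by rewrite /adjacent_coef1 /A /B /Y /Q /W ?hm; case: eps_cases => ->; ring.
have -> : adjacent_coef2 Y w A B w' = 3 * W.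
  by rewrite /adjacent_coef2 /A /B /Y /W ?hm; case: eps_cases => ->; ring.
rewrite cN cubic_norm_order; eexists; rewrite mulrA; reflexivity.
Qed.

(** The second form at z = rho; it is prime to 3 unless 3 divides n + eps, and then
    [skew_norm_theta_rho], at z = rho + theta, takes over. *)
Lemma skew_norm_rho : skew_norm (- (eps + n)) (- 4) (- 4 * eps) = - m * (n + eps) ^+ 2.
Proof. by rewrite /skew_norm hm; case: eps_cases => ->; ring. Qed.

Lemma skew_norm_theta_rho : (3 %| n + eps)%Z ->
  ~~ (3 %| skew_norm (1 - (eps + n)) (- 4) (- 4 * eps))%Z.
Proof.
move=> /dvdzP[k Ek]; have En : n = 3 * k - eps by lia.
have [k' ->] : exists k', skew_norm (1 - (eps + n)) (- 4) (- 4 * eps) = 3 * k' + 1.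
  rewrite /skew_norm hm En; case: eps_cases => ->.
  - by exists (- 81 * k ^+ 3 + 105 * k ^+ 2 - 123 * k + 32); ring.
  by exists (- 81 * k ^+ 3 + 57 * k ^+ 2 + 69 * k + 16); ring.
lia.
Qed.
End IndexFormArithmetic.

Lemma int_mul_eq1 (a b : int) : a * b = 1 -> a = 1 \/ a = -1.
Proof.
move=> ab; have : a \is a GRing.unit by apply/unitrPr; exists b.
by case/orP => /eqP ->; [left | right].
Qed.

Lemma dvdz_mul_self (c F : int) : c != 0 -> (c * F %| c)%Z -> F = 1 \/ F = -1.
Proof.
move=> c0 /dvdzP[k E]; apply: (@int_mul_eq1 _ k); apply: (mulfI c0).
by rewrite mulr1 [RHS]E; ring.
Qed.

(** Modulo m each form reduces to a power of A, which allows the three values to be compared. *)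
Lemma index_form1_mod (m A B C : int) :
  exists s, cubic_norm m A B C = A ^+ 3 + m * s.
Proof. by exists (B ^+ 3 + m * C ^+ 3 - 3 * A * B * C); rewrite /cubic_norm; ring. Qed.

Lemma index_form2_mod (m Y Z A C : int) :
  exists s, cubic_norm m (skew_coef0 m Z A) (skew_coef1 m Y C) (skew_coef2 Y Z A C) = A ^+ 6
    + m * s.
Proof.
have [s ->] := index_form1_mod m (skew_coef0 m Z A) (skew_coef1 m Y C) (skew_coef2 Y Z A C).
exists (s - 3 * A ^+ 4 * Z ^+ 2 + 3 * m * A ^+ 2 * Z ^+ 4 - m ^+ 2 * Z ^+ 6).
by rewrite /skew_coef0; ring.
Qed.

Lemma index_form3_mod (m Y Z A B C : int) :
  exists s, cubic_norm m (adjacent_coef0 m Z A B C) (adjacent_coef1 m Y A B C) (adjacent_coef2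
    Y Z A B C) = A ^+ 6 + m * s.
Proof.
have [s ->] := index_form1_mod m (adjacent_coef0 m Z A B C) (adjacent_coef1 m Y A B C)
  (adjacent_coef2 Y Z A B C).
pose d := 3 * Z ^+ 2 - 4 * B * C.
exists (s + 3 * A ^+ 4 * d + 3 * m * A ^+ 2 * d ^+ 2 + m ^+ 2 * d ^+ 3).
by rewrite /adjacent_coef0 /d; ring.
Qed.

(** The coefficients of the two forms agree modulo 4 one by one, hence so do the norms. *)
Lemma index_form23_mod4 (m Y Z A B C : int) :
  exists s, cubic_norm m (adjacent_coef0 m Z A B C) (adjacent_coef1 m Y A B C) (adjacent_coef2
    Y Z A B C) =
    cubic_norm m (skew_coef0 m Z A) (skew_coef1 m Y C) (skew_coef2 Y Z A C) + 4 * s.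
Proof.
have -> : adjacent_coef0 m Z A B C = skew_coef0 m Z A + 4 * (m * Z ^+ 2 - B * C * m).
  by rewrite /adjacent_coef0 /skew_coef0; ring.
have -> : adjacent_coef1 m Y A B C = skew_coef1 m Y C + 4 * (Y ^+ 2 - A * B)
  by rewrite /adjacent_coef1 /skew_coef1; ring.
have -> : adjacent_coef2 Y Z A B C = skew_coef2 Y Z A C + 4 * (B ^+ 2 + A * C - 2 * Y * Z).
  by rewrite /adjacent_coef2 /skew_coef2; ring.
move: (skew_coef0 _ _ _) (skew_coef1 _ _ _) (skew_coef2 _ _ _ _) (_ - _ * m) (_ - A * B) (_
  - 2 * Y * Z) => a b c u v x.
exists (3 * a ^+ 2 * u + 12 * a * u ^+ 2 + 16 * u ^+ 3
  + m * (3 * b ^+ 2 * v + 12 * b * v ^+ 2 + 16 * v ^+ 3)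
  + m ^+ 2 * (3 * c ^+ 2 * x + 12 * c * x ^+ 2 + 16 * x ^+ 3)
  - 3 * m * (u * (b + 4 * v) * (c + 4 * x) + a * v * (c + 4 * x) + a * b * x)).
by rewrite /cubic_norm; ring.
Qed.

(** * The contradiction from the three index forms *)

Section PlusMinusOneModNine.
Variables (m eps n : int) (K : fieldExtType rat) (theta : K).
Hypotheses (hsf : squarefreez m) (hm0 : m <> 0) (hm1 : m <> 1) (hmN1 : m <> -1).
Hypotheses (htheta : theta ^+ 6 = m%:~R) (hK : <<1%VS; theta>>%VS = {:K}%VS).
Hypotheses (hm : m = eps + 9 * n) (heps : eps ^+ 2 = 1).
Hypothesis m4 : ~~ (4 %| m * (m - 1))%Z.

Lemma coprime_m_3 : coprimez m 3.
Proof.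
rewrite coprimez_sym coprimezE prime_coprime // -dvdzE.
by have := eps_cases heps; lia.
Qed.

Lemma theta_coord : 3%:R * theta = sextic_elt theta 0 0 0 3 0 0.
Proof. by rewrite /sextic_elt; ring. Qed.

Lemma rho_coord (a : int) :
  3%:R * (rho3 eps theta + a%:~R * theta) = sextic_elt theta 1 (- 2 * eps) 1 (3 * a) 0 0.
Proof.
have E3 : 3%:R * rho3 eps theta = (theta ^+ 2 - eps%:~R) ^+ 2.
  by rewrite /rho3 mulrC divfK ?three_neq0.
have Ee : eps%:~R ^+ 2 = 1 :> K by rewrite -rmorphXn heps.
rewrite mulrDr E3 /sextic_elt !rmorphM rmorphN /=.
by ring : Ee.
Qed.

Lemma not_monogenic_pm1_mod_9 : ~ monogenic K.
Proof.
move=> [alpha [ia aP]]; have IP := integer_subring K.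
have it : ring_of_integers theta := theta_integer htheta.
have ir : ring_of_integers (rho3 eps theta) := rho_integer htheta hm heps.
have [p [q [w [p' [q' [w' Ea]]]]]] := order3_coordP htheta hm heps
  (integer_order3 hsf hm0 hm1 hmN1 htheta hK hm heps m4 ia).
have at_ : in_Zadjoin alpha theta by apply/aP.
have ar (a : int) : in_Zadjoin alpha (rho3 eps theta + a%:~R * theta).
  by apply/aP; subr_tac IP.
have D1 := index_form1_dvd hsf hm0 hm1 hmN1 htheta hK ia at_ Ea theta_coord.
have D2 := index_form2_dvd hsf hm0 hm1 hmN1 htheta hK ia at_ Ea theta_coord.
have D3 := index_form3_dvd hsf hm0 hm1 hmN1 htheta hK ia at_ Ea theta_coord.
have Dr a := index_form2_dvd hsf hm0 hm1 hmN1 htheta hK ia (ar a) Ea (rho_coord a).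
have [s1 M1] := index_form1_mod m (3 * p' + w') (3 * q' - 2 * eps * w') w'.
have [s2 M2] := index_form2_mod m (3 * q - 2 * eps * w) w (3 * p' + w') w'.
have [s3 M3] := index_form3_mod m (3 * q - 2 * eps * w) w (3 * p' + w') (3 * q' - 2 * eps
  * w') w'.
have [s4 M4] := index_form23_mod4 m (3 * q - 2 * eps * w) w (3 * p' + w') (3 * q' - 2 * eps
  * w') w'.
have [F3 E3] := index_form3_order hm heps q w p' q' w'.
have E2 := index_form2_order hm heps q w p' w'.
have E1 := cubic_norm_order hm heps p' q' w'.
move: (skew_norm _ _ _ _ _ _) E2 => F2 /= E2.
move: E1; set F1 := (X in 27 * X) => E1.
have {}Dr a : (F2 %| skew_norm m eps n (a ^+ 2 - (eps + n)) (- 4) (- 4 * eps))%Z.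
  rewrite -(@dvdz_mul2l 81) //; move: (Dr a); rewrite E2 -(cubic_norm_skew hm heps).
  congr (_ %| cubic_norm _ _ _ _)%Z; rewrite /skew_coef0 /skew_coef1 /skew_coef2.
  - rewrite hm; case: (eps_cases heps) => ->; ring.
  - rewrite hm; case: (eps_cases heps) => ->; ring.
  - by ring.
rewrite E1 in D1 M1; rewrite E2 in D2 M2 M4; rewrite E3 in D3 M3 M4.
(* At z = theta the forms take the values 27, 729 = 81 * 9 and 729: F1 and F3 are units, but F2 is
   only known to divide 9. *)
have {D1} F1u : F1 = 1 \/ F1 = -1.
  by apply: (@dvdz_mul_self 27) => //; move: D1; rewrite /cubic_norm; congr (_ %| _)%Z; ring.
have {D3} F3u : F3 = 1 \/ F3 = -1.
  by apply: (@dvdz_mul_self 729) => //; move: D3;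
    rewrite /cubic_norm /adjacent_coef0 /adjacent_coef1 /adjacent_coef2;
    congr (_ %| _)%Z; ring.
have {D2} F29 : (F2 %| 9)%Z.
  by rewrite -(@dvdz_mul2l 81) //; move: D2;
    rewrite /cubic_norm /skew_coef0 /skew_coef1 /skew_coef2;
    congr (_ %| _)%Z; ring.
have F23 : ~~ (3 %| F2)%Z.
  apply/negP => F23; have [n3|n3] := boolP (3 %| n + eps)%Z.
    by apply: (negP (skew_norm_theta_rho hm heps n3)); apply: dvdz_trans F23 (Dr 1).
  have := dvdz_trans F23 (Dr 0); rewrite expr0n /= sub0r (skew_norm_rho hm heps).
  rewrite Gauss_dvdzr; last by rewrite coprimezN coprimez_sym coprime_m_3.
  by rewrite dvdzE abszX Euclid_dvdX // andbT -dvdzE; exact/negP.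
have {F29 F23 Dr} F2u : F2 = 1 \/ F2 = -1.
  have co : coprimez F2 (3 ^+ 2).
    by rewrite coprimez_pexpr // coprimez_sym coprimezE prime_coprime.
  by apply: (@dvdz_mul_self 1) => //; rewrite mul1r -(Gauss_dvdzr _ co) mulr1.
have m3 j a : (m %| 3 ^+ j.+1 * a)%Z -> (m %| a)%Z.
  by rewrite Gauss_dvdzr // coprimez_pexpr // coprime_m_3.
clear - hm heps hm1 hmN1 m4 M1 M2 M3 M4 F1u F2u F3u m3.
move: (3 * p' + w') M1 M2 M3 => A M1 M2 M3.
have F11 : F1 ^+ 2 = 1 by case: F1u => ->.
(* Squaring M1 gives A^6 = 729 (mod m). With M2 and M3, and m prime to 3, this yields F2 = 9 and F3
   = 1 modulo m. *)
have G1 : 729 = A ^+ 6 + m * (2 * A ^+ 3 * s1 + m * s1 ^+ 2).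
  have -> : 729 = (27 * F1) ^+ 2 by rewrite exprMn F11.
  by rewrite M1; ring.
have d2 : (m %| F2 - 9)%Z.
  apply/(m3 3%N)/dvdzP; exists (s2 - (2 * A ^+ 3 * s1 + m * s1 ^+ 2)).
  have -> : 3 ^+ 4 * (F2 - 9) = 81 * F2 - 729 by ring.
  by rewrite M2 G1; ring.
have d3 : (m %| F3 - 1)%Z.
  apply/(m3 5%N)/dvdzP; exists (s3 - (2 * A ^+ 3 * s1 + m * s1 ^+ 2)).
  have -> : 3 ^+ 6 * (F3 - 1) = 729 * F3 - 729 by ring.
  by rewrite M3 G1; ring.
(* Both 81 and 729 are 1 modulo 4, so M4 gives F2 = F3 (mod 4), and both are +-1. *)
have E23 : F2 = F3 by clear - F2u F3u M4; lia.
(* If F2 = F3 = 1, then m divides 8; if both are -1, then m divides 2. *)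
have m8 : (`|m| <= 8)%N.
  case: F2u E23 d2 d3 => -> <- d2 d3; rewrite dvdzE in d2 d3.
    exact: (dvdn_leq _ d2).
  by apply: leq_trans (dvdn_leq _ d3) _.
(* These are the values with m = +-1 (mod 9) in this range; 8 and -8 contradict [m4]. *)
have : m \in [:: 1; -1; 8; -8] by rewrite !inE; clear - hm heps m8; have := eps_cases heps; lia.
by rewrite !inE => /or4P[] /eqP Em; move: m4 hm1 hmN1; rewrite Em.
Qed.
End PlusMinusOneModNine.

(** * From residues modulo 36 to the conditions modulo 4 and 9 *)

Lemma residue_mod4 (r k m : int) : m = r + 36 * k ->
  exists x, m * (m - 1) = 4 * x + r * (r - 1).
Proof. by move=> ->; exists (9 * k * (2 * r - 1) + 324 * k ^+ 2); ring. Qed.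

Lemma residue_mod9 (r k m : int) : m = r + 36 * k ->
  exists x, m ^+ 2 - 1 = 9 * x + (r ^+ 2 - 1).
Proof. by move=> ->; exists (8 * r * k + 144 * k ^+ 2); ring. Qed.

(* K = Q(theta) with theta any sixth root of m in K; under the hypotheses
   X^6 - m is irreducible over Q, so K is unique up to isomorphism. *)
Theorem theorem5 (k m : int) (r : nat)
  (hr : r \in [:: 1; 2; 3; 5; 6; 7; 10; 11; 13; 14; 15; 17; 19; 21; 22; 23;
                  25; 26; 29; 30; 31; 33; 34; 35]%N)
  (hm : m = r%:Z + 36%:Z * k)
  (hsf : squarefreez m) (hm0 : m <> 0) (hm1 : m <> 1) (hmN1 : m <> -1)
  (K : fieldExtType rat) (theta : K)
  (htheta : theta ^+ 6 = m%:~R)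
  (hK : <<1%VS; theta>>%VS = {:K}%VS) :
  (r \in [:: 2; 3; 6; 7; 11; 14; 15; 22; 23; 30; 31; 34]%N -> monogenic K) /\
  (r \in [:: 1; 5; 10; 13; 17; 19; 21; 25; 26; 29; 33; 35]%N -> ~ monogenic K).
Proof.
have [x4 E4] := residue_mod4 hm; have [x9 E9] := residue_mod9 hm.
split=> [hr1|hr2].
  apply: (Zadjoin_theta_monogenic hsf hm0 hm1 hmN1 htheta hK).
  - rewrite E4; clear - hr1; move: hr1; rewrite !inE.
    by do ![case/orP => [/eqP ->|]; first lia]; move/eqP->; lia.
  - rewrite E9; clear - hr1; move: hr1; rewrite !inE.
    by do ![case/orP => [/eqP ->|]; first lia]; move/eqP->; lia.
(* The residues 1, 5, 13, 17, 21, 25, 29, 33 are 1 modulo 4; of the others, 10 and 19 are 1 modulo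
   9, while 26 and 35 are -1. *)
have [m14|m14] := boolP (4 %| m - 1)%Z.
  exact: (not_monogenic_1_mod_4 hsf hm0 hm1 hmN1 htheta hK m14).
have [e [n [En He r4]]] : exists e n, [/\ m = e + 9 * n, e ^+ 2 = 1 &
    r%:Z \in [:: 10; 19; 26; 35] ].
  clear - hr2 m14 hm; move: hr2; rewrite !inE => hr2.
  have [E|[E|[E|E]]] : r = 10%N \/ r = 19%N \/ r = 26%N \/ r = 35%N by lia.
  - by rewrite E in hm *; exists 1, (1 + 4 * k); split => //; lia.
  - by rewrite E in hm *; exists 1, (2 + 4 * k); split => //; lia.
  - by rewrite E in hm *; exists (-1), (3 + 4 * k); split => //; lia.
  - by rewrite E in hm *; exists (-1), (4 + 4 * k); split => //; lia.
apply: (not_monogenic_pm1_mod_9 hsf hm0 hm1 hmN1 htheta hK En He).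
by rewrite E4; clear - r4; move: r4; rewrite !inE => /or4P[] /eqP ->; lia.
Qed.
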